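(* Let $r \geq 1$, $k \geq 1$ and $\mu \geq 0$ be integers, let $\beta$ be a primitive $r$th root of unity, let $q(w) = w^k + q_{k-1} w^{k-1} + \cdots + q_1 w + q_0$ be a monic polynomial of degree $k$ with complex coefficients, and let $F: \mathbb{C}^2 \to \mathbb{C}^2$ be the elementary map $$F(z,w) = \bigl(\beta^\mu (z + w^\mu q(w^r)), \beta w\bigr).$$ Then: (1) $F$ has compositional roots of arbitrarily high order; that is, for every $N$ there exist an integer $n \geq N$ and an automorphism $\phi$ of $\mathbb{C}^2$ with $\phi^n = F$. (2) Any compositional root of $F$ is conjugate to a polynomial elementary map; that is, if $n \geq 1$ and $\phi$ is an automorphism of $\mathbb{C}^2$ with $\phi^n = F$, then there is an automorphism $\psi$ of $\mathbb{C}^2$ such that $\psi^{-1} \circ \phi \circ \psi$ is a polynomial elementary automorphism of $\mathbb{C}^2$.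
   Context: An automorphism of $\mathbb{C}^2$ is a biholomorphic map of $\mathbb{C}^2$ onto itself (not assumed polynomial). $\phi^n$ denotes the $n$-fold composition of $\phi$ with itself. An elementary polynomial automorphism of $\mathbb{C}^2$ is a polynomial automorphism which preserves the set of lines of the form $w = \mathrm{const}$, i.e. a map $(z,w) \mapsto (\alpha z + p(w), \gamma w + \delta)$ with $\alpha, \gamma \in \mathbb{C} \setminus \{0\}$, $\delta \in \mathbb{C}$ and $p$ a polynomial. *)

(* Defs.v *)
From HB Require Import structures.
From mathcomp Require Import all_boot all_order all_algebra.
From mathcomp Require Import all_classical all_reals all_analysis.
From mathcomp Require Import complex Rstruct.

Set Implicit Arguments.
Unset Strict Implicit.
Unset Printing Implicit Defensive.

Import Order.TTheory GRing.Theory Num.Theory.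
Import numFieldNormedType.Exports.

Local Open Scope ring_scope.

(* R[i] as a normed space over itself, so that differentiability of maps
   between products of copies of R[i] means complex differentiability. *)
Set Warnings "-redundant-canonical-projection".
HB.instance Definition _ (R : rcfType) := NormedModule.copy R[i] R[i]^o.
Set Warnings "redundant-canonical-projection".

Notation C := (Rdefinitions.R[i]).
Notation C2 := (C * C)%type.

(* The scalar field is C: this is Frechet differentiability with a C-linear
   differential at every point. *)
Definition holomorphic (f : C2 -> C2) : Prop :=
  forall x : C2, differentiable f x.

Definition inverse_biholomorphisms (f g : C2 -> C2) : Prop :=
  [/\ cancel f g, cancel g f, holomorphic f & holomorphic g].

Definition automorphism (f : C2 -> C2) : Prop :=
  exists g : C2 -> C2, inverse_biholomorphisms f g.

Definition polynomial_elementary (f : C2 -> C2) : Prop :=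
  exists (alpha gamma delta : C) (p : {poly C}),
    [/\ alpha != 0, gamma != 0
      & forall z w : C, f (z, w) = (alpha * z + p.[w], gamma * w + delta)].

Definition F_map (r mu : nat) (beta : C) (q : {poly C}) : C2 -> C2 :=
  fun '(z, w) => (beta ^+ mu * (z + w ^+ mu * q.[w ^+ r]), beta * w).

(* Main.v *)
Require Import Defs.
From HB Require Import structures.
From mathcomp Require Import all_boot all_order all_algebra.
From mathcomp Require Import all_classical all_reals all_analysis.
From mathcomp Require Import complex Rstruct Rstruct_topology.
From Stdlib Require Reals Lra ClassicalEpsilon List FinFun.
From Coquelicot Require Coquelicot.

Set Implicit Arguments.
Unset Strict Implicit.
Unset Printing Implicit Defensive.

(** The iterate [G = F^r] is the shear [(z, w) |-> (z + Q(w), w)], where [Q] is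
    [r] times the nonconstant polynomial [w^mu q(w^r)].  It has roots of every
    order [n], obtained by dividing [Q] by [n], and dividing the polynomial of
    [F] itself by [n] gives an [n]-th root of [F] as soon as [n = 1] modulo [r].

    Conversely a root [phi] of [F] commutes with [G], so its second component
    [g] satisfies [g (z + Q(w), w) = g (z, w)].  The key point
    ([shear_invariant]) is that such a [g] depends on [w] only.  Let [p] be a
    zero of [Q].  When [w] approaches [p] the period [Q(w)] tends to [0], so
    [g (., w) - g (0, w)] has at least a multiple of [1 / |w - p|] zeros in a
    fixed disc; a Schwarz lemma with many zeros makes it exponentially small,
    hence the entire function [w |-> g (z, w) - g (0, w)] is flat at [p] and
    vanishes.  The same lemma applied to the differences
    [f (z + s, w) - f (z, w)] of the first component gives
    [f (z, w) = a(w) z + b(w)].  As [phi^-1] commutes with [G] too, [g] is a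
    biholomorphism of the plane, hence affine ([biholomorphism_affine]), and
    [a Q = Q o g] makes [a] a polynomial without zeros, that is a constant
    ([shear_centralizer]).

    Thus [phi (z, w) = (a z + b(w), g(w))] where the [M]-th iterate of [g] is
    the identity and [a^M = 1], for a multiple [M] of [r].  Average [b] over
    the cyclic group generated by [L : b |-> a^-1 (b o g)].  The average is a
    polynomial, because the first component of [phi^M = (z + polynomial, w)] displays it;
    the rest, [b] minus its average, is a coboundary [s o g - a s], which
    conjugation by [(z, w) |-> (z + s(w), w)] removes
    ([conjugate_to_polynomial]).

    The function theory is developed from Goursat's lemma on rectangles and is
    reduced to one tool, the maximum principle [maximum_principle], stated for
    continuous functions that are differentiable off a finite set, a class
    that is stable under the division [(u(x) - u(p)) / (x - p)]. *)

(** * Complex differentiability in one variable *)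
Module ComplexAnalysis.
Import Stdlib.Reals.Reals Stdlib.micromega.Lra Stdlib.Logic.ClassicalEpsilon Stdlib.Lists.List.
Import Coquelicot.Coquelicot.
Local Open Scope R_scope.
Local Open Scope C_scope.
Implicit Types (u v s : C -> C) (z : C).

Definition cts (u : C -> C) (z : C) : Prop :=
  forall e : R, (0 < e)%R -> exists d : R, (0 < d)%R /\
    forall x, (Cmod (x - z) < d)%R -> (Cmod (u x - u z) < e)%R.

(** Caratheodory's form of differentiability: the difference quotient extends
    continuously through [z].  It reduces the rules of calculus to those for
    continuity, and at the same time [s] is the result of dividing [u - u z]
    by [x - z]. *)
Definition slope (u : C -> C) (z : C) (s : C -> C) : Prop :=
  cts s z /\ forall x, u x - u z = s x * (x - z).

Definition cdiff (u : C -> C) (z : C) : Prop := exists s, slope u z s.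

Lemma cts_ext u v z : (forall x, u x = v x) -> cts u z -> cts v z.
Proof.
move=> uv hu e e0; have [d [d0 hd]] := hu e e0.
by exists d; split=> // x hx; rewrite -!uv; exact: hd.
Qed.

Lemma cts_const c z : cts (fun=> c) z.
Proof.
move=> e e0; exists 1%R; split; first lra.
by move=> x _; rewrite (_ : c - c = 0) ?Cmod_0 //; ring.
Qed.

Lemma cts_id z : cts (fun x => x) z.
Proof. by move=> e e0; exists e. Qed.

Lemma cts_plus u v z : cts u z -> cts v z -> cts (fun x => u x + v x) z.
Proof.
move=> hu hv e e0.
have [|d1 [d10 h1]] := hu (e / 2)%R; first lra.
have [|d2 [d20 h2]] := hv (e / 2)%R; first lra.
exists (Rmin d1 d2); split; first exact: Rmin_pos.
move=> x hx.
have := h1 x (Rlt_le_trans _ _ _ hx (Rmin_l _ _)).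
have := h2 x (Rlt_le_trans _ _ _ hx (Rmin_r _ _)).
rewrite (_ : u x + v x - (u z + v z) = (u x - u z) + (v x - v z)); last by ring.
have := Cmod_triangle (u x - u z) (v x - v z); lra.
Qed.

Lemma cts_mult u v z : cts u z -> cts v z -> cts (fun x => u x * v x) z.
Proof.
move=> hu hv e e0.
have A0 := Cmod_ge_0 (u z); have B0 := Cmod_ge_0 (v z).
set A := Cmod (u z) in A0 *; set B := Cmod (v z) in B0 *.
have S0 : (0 < A + B + 1)%R by lra.
set eta := Rmin 1 (e / (A + B + 1)).
have eta0 : (0 < eta)%R by apply: Rmin_pos; [lra | exact: Rdiv_lt_0_compat].
have [d1 [d10 h1]] := hu _ eta0.
have [d2 [d20 h2]] := hv _ eta0.
exists (Rmin d1 d2); split; first exact: Rmin_pos.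
move=> x hx.
have {}h1 := h1 x (Rlt_le_trans _ _ _ hx (Rmin_l _ _)).
have {}h2 := h2 x (Rlt_le_trans _ _ _ hx (Rmin_r _ _)).
have E : (eta * (A + B + 1) <= e)%R.
  apply: (Rle_trans _ (e / (A + B + 1) * (A + B + 1))).
    by apply: Rmult_le_compat_r; [lra | exact: Rmin_r].
  by right; field; lra.
have E1 : (eta <= 1)%R by exact: Rmin_l.
rewrite (_ : u x * v x - u z * v z
   = (u x - u z) * (v x - v z) + ((u x - u z) * v z + u z * (v x - v z))); last by ring.
have t1 := Cmod_triangle ((u x - u z) * (v x - v z)) ((u x - u z) * v z + u z * (v x - v z)).
have t2 := Cmod_triangle ((u x - u z) * v z) (u z * (v x - v z)).
rewrite !Cmod_mult -/A -/B in t1 t2.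
move: (Cmod_ge_0 (u x - u z)) (Cmod_ge_0 (v x - v z)) h1 h2 t1 t2.
move: (Cmod (u x - u z)) (Cmod (v x - v z)) => p q; nra.
Qed.

Lemma cts_comp u v z : cts v z -> cts u (v z) -> cts (fun x => u (v x)) z.
Proof.
move=> hv hu e e0; have [d [d0 hd]] := hu e e0; have [d' [d'0 hd']] := hv d d0.
by exists d'; split=> // x hx; apply: hd; apply: hd'.
Qed.

Lemma cts_Cinv (z : C) : z <> 0 -> cts Cinv z.
Proof.
move=> z0' e e0; have z0 := proj1 (Cmod_gt_0 z) z0'; set A := Cmod z in z0 *.
exists (Rmin (A / 2) (e * (A * A) / 2)); split.
  by apply: Rmin_pos; first lra; have := Rmult_lt_0_compat _ _ z0 z0; nra.
move=> x hx.
have h1 := Rlt_le_trans _ _ _ hx (Rmin_l _ _).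
have h2 := Rlt_le_trans _ _ _ hx (Rmin_r _ _).
have xA : (A / 2 < Cmod x)%R.
  have := Cmod_triangle x (z - x); rewrite (_ : x + (z - x) = z); last by ring.
  by rewrite -(Cmod_opp (z - x)) (_ : - (z - x) = x - z) -/A; [lra | ring].
have x0 : x <> 0 by apply: (proj2 (Cmod_gt_0 x)); lra.
rewrite (_ : / x - / z = - (x - z) / (x * z)); last by field; split.
rewrite Cmod_div; last exact: Cmult_neq_0.
rewrite Cmod_opp Cmod_mult -/A.
apply/Rlt_div_l; first by apply: Rmult_lt_0_compat; lra.
apply: Rlt_le_trans h2 _.
have := Rmult_lt_0_compat _ _ e0 z0; nra.
Qed.

Lemma cts_inv u z : u z <> 0 -> cts u z -> cts (fun x => / u x) z.
Proof. by move=> u0 hu; apply: (cts_comp hu); exact: cts_Cinv. Qed.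

Lemma cts_opp u z : cts u z -> cts (fun x => - u x) z.
Proof.
move=> hu; apply: (@cts_ext (fun x => - (1) * u x)); first by move=> x; ring.
by apply: cts_mult => //; exact: cts_const.
Qed.

Lemma cts_minus u v z : cts u z -> cts v z -> cts (fun x => u x - v x) z.
Proof. by move=> hu hv; apply: cts_plus => //; exact: cts_opp. Qed.

Lemma cts_pow u n z : cts u z -> cts (fun x => Cpow (u x) n) z.
Proof.
by move=> hu; elim: n => [|n IH]; [exact: cts_const | exact: cts_mult].
Qed.

Lemma cdiff_cts u z : cdiff u z -> cts u z.
Proof.
move=> [s [hs us]].
apply: (@cts_ext (fun x => s x * (x - z) + u z)); first by move=> x; rewrite -us; ring.
apply: cts_plus; last exact: cts_const.
apply: cts_mult => //; apply: cts_minus; [exact: cts_id | exact: cts_const].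
Qed.

Lemma cdiff_ext u v z : (forall x, u x = v x) -> cdiff u z -> cdiff v z.
Proof. by move=> uv [s [hs us]]; exists s; split=> // x; rewrite -!uv. Qed.

Lemma cdiff_const c z : cdiff (fun=> c) z.
Proof. by exists (fun=> 0); split; [exact: cts_const | move=> x; ring]. Qed.

Lemma cdiff_plus u v z : cdiff u z -> cdiff v z -> cdiff (fun x => u x + v x) z.
Proof.
move=> [s [hs us]] [t [ht vt]]; exists (fun x => s x + t x); split; first exact: cts_plus.
by move=> x; rewrite Cmult_plus_distr_r -us -vt; ring.
Qed.

Lemma cdiff_mult u v z : cdiff u z -> cdiff v z -> cdiff (fun x => u x * v x) z.
Proof.
move=> hu hv; have cv := cdiff_cts hv.
move: hu hv => [s [hs us]] [t [ht vt]]; exists (fun x => s x * v x + u z * t x); split.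
  by apply: cts_plus; apply: cts_mult => //; exact: cts_const.
move=> x.
rewrite (_ : (s x * v x + u z * t x) * (x - z) = (s x * (x - z)) * v x + u z * (t x * (x - z)));
  last by ring.
by rewrite -us -vt; ring.
Qed.

Lemma cdiff_opp u z : cdiff u z -> cdiff (fun x => - u x) z.
Proof.
move=> hu; apply: (@cdiff_ext (fun x => - (1) * u x)); first by move=> x; ring.
by apply: cdiff_mult => //; exact: cdiff_const.
Qed.

Lemma cdiff_minus u v z : cdiff u z -> cdiff v z -> cdiff (fun x => u x - v x) z.
Proof. by move=> hu hv; apply: cdiff_plus => //; exact: cdiff_opp. Qed.

Lemma cdiff_pow u n z : cdiff u z -> cdiff (fun x => Cpow (u x) n) z.
Proof.
by move=> hu; elim: n => [|n IH]; [exact: cdiff_const | exact: cdiff_mult].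
Qed.

Lemma cdiff_inv u z : (forall x, u x <> 0) -> cdiff u z -> cdiff (fun x => / u x) z.
Proof.
move=> u0 hu; have cu := cdiff_cts hu; move: hu => [s [hs us]].
exists (fun x => - s x * (/ u z * / u x)); split.
  apply: cts_mult; first exact: cts_opp.
  by apply: cts_mult; [exact: cts_const | exact: cts_inv].
move=> x.
rewrite (_ : - s x * (/ u z * / u x) * (x - z) = - (s x * (x - z)) * (/ u z * / u x)); last by ring.
by rewrite -us; field; split.
Qed.

(** * Integration along the boundary of a rectangle *)

Lemma continuous_cts (g : R -> C) u (t : R) :
  (forall t1 t2, Cmod (g t1 - g t2) <= Rabs (t1 - t2))%R -> (forall z, cts u z) ->
  continuous (T := R_UniformSpace) (U := C_UniformSpace) (fun t => u (g t)) t.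
Proof.
move=> hg hu; apply/filterlim_locally => e.
have [d [d0 hd]] := hu (g t) e (cond_pos e).
exists (mkposreal d d0) => t' ht.
have H : (Cmod (u (g t') - u (g t)) < e)%R.
  by apply: hd; apply: Rle_lt_trans ht; apply: hg.
have h := Rle_lt_trans _ _ _ (Rmax_Cmod (u (g t') - u (g t))) H.
split.
- by apply: Rle_lt_trans h; apply: Rmax_l.
- by apply: Rle_lt_trans h; apply: Rmax_r.
Qed.

Lemma Cmod_hline (c t1 t2 : R) : (Cmod ((t1, c) - (t2, c)) <= Rabs (t1 - t2))%R.
Proof.
rewrite (_ : ((t1, c) - (t2, c))%C = RtoC (t1 - t2)%R) ?Cmod_R; first exact: Rle_refl.
by rewrite /Cminus /Cplus /Copp /RtoC /=; congr pair; ring.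
Qed.

Lemma Cmod_vline (c t1 t2 : R) : (Cmod ((c, t1) - (c, t2)) <= Rabs (t1 - t2))%R.
Proof.
rewrite (_ : ((c, t1) - (c, t2))%C = Ci * RtoC (t1 - t2)%R).
  by rewrite Cmod_mult Cmod_Ci Cmod_R Rmult_1_l; exact: Rle_refl.
by rewrite /Cminus /Cplus /Copp /Cmult /Ci /RtoC /=; congr pair; ring.
Qed.

Definition int (f : R -> C) (a b : R) : C := RInt (V := C_R_CompleteNormedModule) f a b.
Definition integrable (f : R -> C) := forall a b, ex_RInt (V := C_R_CompleteNormedModule) f a b.
Definition cts_fun u := forall z, cts u z.

Lemma integrable_h u c : cts_fun u -> integrable (fun t => u (t, c)).
Proof.
move=> hu a b; apply: ex_RInt_continuous => t _.
exact: (@continuous_cts (fun t => (t, c))) (Cmod_hline c) hu.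
Qed.

Lemma integrable_v u c : cts_fun u -> integrable (fun t => u (c, t)).
Proof.
move=> hu a b; apply: ex_RInt_continuous => t _.
exact: (@continuous_cts (fun t => (c, t))) (Cmod_vline c) hu.
Qed.

Lemma integrable_minus f g : integrable f -> integrable g -> integrable (fun t => f t - g t).
Proof. by move=> hf hg a b; exact: (@ex_RInt_minus C_R_NormedModule). Qed.

Lemma int_plus f g a b : integrable f -> integrable g ->
  int (fun t => f t + g t) a b = int f a b + int g a b.
Proof. by move=> hf hg; exact: (@RInt_plus C_R_CompleteNormedModule). Qed.

Lemma int_Chasles f a b c : integrable f -> int f a b + int f b c = int f a c.
Proof. by move=> hf; exact: (@RInt_Chasles C_R_CompleteNormedModule). Qed.

Lemma int_ext f g a b : (forall t, f t = g t) -> int f a b = int g a b.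
Proof. by move=> fg; apply: (@RInt_ext C_R_CompleteNormedModule) => t _. Qed.

Lemma int_const c a b : int (fun=> c) a b = RtoC (b - a)%R * c.
Proof.
rewrite /int (@RInt_const C_R_CompleteNormedModule).
by case: c => x y; rewrite /scal /= /prod_scal /scal /= /mult /= /Cmult /=; congr pair; ring.
Qed.

Lemma Cmod_int_le f a b M : integrable f -> (a <= b)%R ->
  (forall t, (a <= t <= b)%R -> (Cmod (f t) <= M)%R) -> (Cmod (int f a b) <= (b - a) * M)%R.
Proof.
move=> hf ab hM; rewrite Cmod_norm.
apply: (@norm_RInt_le_const C_R_NormedModule f) => //.
  by move=> t ht; rewrite -Cmod_norm; exact: hM.
exact: (@RInt_correct C_R_CompleteNormedModule).
Qed.

(** The integral of [u] along the counterclockwise boundary of [a, b] x [c, d],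
    with opposite sides grouped together: each side alone would require the
    antiderivative of an affine function in [bdint_affine], while the
    differences of opposite sides are then constant. *)
Definition bdint u (a b c d : R) : C :=
  int (fun t => u (t, c) - u (t, d)) a b + Ci * int (fun t => u (b, t) - u (a, t)) c d.

Lemma bdint_ext u v a b c d : (forall z, u z = v z) -> bdint u a b c d = bdint v a b c d.
Proof. by move=> uv; rewrite /bdint; congr (_ + _ * _); apply: int_ext => t; rewrite !uv. Qed.

Lemma bdint_plus u v a b c d : cts_fun u -> cts_fun v ->
  bdint (fun z => u z + v z) a b c d = bdint u a b c d + bdint v a b c d.
Proof.
move=> hu hv; rewrite /bdint.
rewrite (@int_ext _ (fun t => (u (t, c) - u (t, d)) + (v (t, c) - v (t, d)))); last by move=> t; ring.
rewrite (@int_ext (fun t => u (b, t) + _ - _) (fun t => (u (b, t) - u (a, t)) + (v (b, t) - v (a, t))));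
  last by move=> t; ring.
have ih w : cts_fun w -> integrable (fun t => w (t, c) - w (t, d)).
  by move=> hw; apply: integrable_minus; exact: integrable_h.
have iv w : cts_fun w -> integrable (fun t => w (b, t) - w (a, t)).
  by move=> hw; apply: integrable_minus; exact: integrable_v.
by rewrite (int_plus _ _ (ih u hu) (ih v hv)) (int_plus _ _ (iv u hu) (iv v hv)); ring.
Qed.

Lemma bdint_affine p q a b c d : bdint (fun z => p + q * z) a b c d = 0.
Proof.
rewrite /bdint (@int_ext _ (fun=> q * ((0, c) - (0, d)))); last first.
  by move=> t; rewrite /Cminus /Cplus /Copp /Cmult /=; congr pair; ring.
rewrite (@int_ext (fun t => p + _ - _) (fun=> q * (RtoC b - RtoC a))); last first.
  by move=> t; rewrite /Cminus /Cplus /Copp /Cmult /=; congr pair; ring.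
rewrite !int_const /Ci /RtoC /Cminus /Cplus /Copp /Cmult /=; congr pair; ring.
Qed.

Lemma bdint_split_h u a m b c d : cts_fun u -> bdint u a b c d = bdint u a m c d + bdint u m b c d.
Proof.
move=> hu; rewrite /bdint.
rewrite -(@int_Chasles _ a m b); last by apply: integrable_minus; exact: integrable_h.
rewrite (@int_ext (fun t => u (b, t) - u (a, t))
  (fun t => (u (b, t) - u (m, t)) + (u (m, t) - u (a, t)))); last by move=> t; ring.
by rewrite (@int_plus (fun t => u (b, t) - u (m, t)));
  [ring | apply: integrable_minus; exact: integrable_v..].
Qed.

Lemma bdint_split_v u a b c m d : cts_fun u -> bdint u a b c d = bdint u a b c m + bdint u a b m d.
Proof.
move=> hu; rewrite /bdint.
rewrite -(@int_Chasles _ c m d); last by apply: integrable_minus; exact: integrable_v.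
rewrite (@int_ext (fun t => u (t, c) - u (t, d))
  (fun t => (u (t, c) - u (t, m)) + (u (t, m) - u (t, d)))); last by move=> t; ring.
by rewrite (@int_plus (fun t => u (t, c) - u (t, m)));
  [ring | apply: integrable_minus; exact: integrable_h..].
Qed.

Definition in_rect (a b c d : R) (z : C) := (a <= z.1 <= b)%R /\ (c <= z.2 <= d)%R.

Lemma Cmod_le_add z : (Cmod z <= Rabs z.1 + Rabs z.2)%R.
Proof.
case: z => x y /=; rewrite (_ : (x, y) = RtoC x + Ci * RtoC y).
  by have := Cmod_triangle (RtoC x) (Ci * RtoC y); rewrite Cmod_mult Cmod_Ci !Cmod_R; lra.
by rewrite /Ci /RtoC /Cplus /Cmult /=; congr pair; ring.
Qed.

Lemma Cmod_bdint_le u a b c d M : cts_fun u -> (a <= b)%R -> (c <= d)%R ->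
  (forall z, in_rect a b c d z -> (Cmod (u z) <= M)%R) ->
  (Cmod (bdint u a b c d) <= 2 * M * ((b - a) + (d - c)))%R.
Proof.
move=> hu ab cd hM.
have ih : (Cmod (int (fun t => (u (t, c) - u (t, d))%C) a b) <= (b - a) * (2 * M))%R.
  apply: Cmod_int_le => //; first by apply: integrable_minus; exact: integrable_h.
  move=> t ht; have := Cmod_triangle (u (t, c)) (- u (t, d)); rewrite Cmod_opp.
  have := hM (t, c); have := hM (t, d); rewrite /in_rect /=.
  move=> h1 h2; have {}h1 : (Cmod (u (t, d)) <= M)%R by apply: h1; lra.
  have {}h2 : (Cmod (u (t, c)) <= M)%R by apply: h2; lra.
  rewrite /Cminus; lra.
have iv : (Cmod (int (fun t => (u (b, t) - u (a, t))%C) c d) <= (d - c) * (2 * M))%R.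
  apply: Cmod_int_le => //; first by apply: integrable_minus; exact: integrable_v.
  move=> t ht; have := Cmod_triangle (u (b, t)) (- u (a, t)); rewrite Cmod_opp.
  have := hM (b, t); have := hM (a, t); rewrite /in_rect /=.
  move=> h1 h2; have {}h1 : (Cmod (u (a, t)) <= M)%R by apply: h1; lra.
  have {}h2 : (Cmod (u (b, t)) <= M)%R by apply: h2; lra.
  rewrite /Cminus; lra.
rewrite /bdint; apply: Rle_trans (Cmod_triangle _ _) _.
rewrite Cmod_mult Cmod_Ci; lra.
Qed.

(** * Goursat's lemma and isolated exceptional points *)

Lemma nested_intervals (a b : nat -> R) :
  (forall n, (a n <= a n.+1)%R) -> (forall n, (b n.+1 <= b n)%R) -> (forall n, (a n <= b n)%R) ->
  exists p : R, forall n, (a n <= p <= b n)%R.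
Proof.
move=> ha hb hab.
have am n k : (a n <= a (addn k n))%R.
  by elim: k => [|k IH]; [exact: Rle_refl | apply: Rle_trans IH (ha _)].
have bm n k : (b (addn k n) <= b n)%R.
  by elim: k => [|k IH]; [exact: Rle_refl | apply: Rle_trans (hb _) IH].
have anb n m : (a n <= b m)%R.
  have := am n m; have := bm m n; have := hab (addn n m); rewrite (addnC m n); lra.
have [| |p [hp1 hp2]] := completeness (fun t : R => exists n, t = a n).
- by exists (b O) => x [n ->]; exact: anb.
- by exists (a O); exists O.
exists p => n; split; first by apply: hp1; exists n.
by apply: hp2 => x [m ->]; exact: anb.
Qed.

Lemma half_pow_small (L d : R) : (0 < d)%R -> exists n, (L * (1 / 2) ^ n < d)%R.
Proof.
move=> d0; have L0 := Rabs_pos L.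
have [||N hN] := pow_lt_1_zero (1 / 2) _ (d / (Rabs L + 1)).
- by rewrite Rabs_pos_eq; lra.
- by apply: Rdiv_lt_0_compat; lra.
have := hN N (le_n N); set q := ((1 / 2) ^ N)%R.
have q0 : (0 < q)%R by apply: pow_lt; lra.
rewrite (Rabs_pos_eq q); last lra.
move/(Rlt_div_r _ _ (Rabs L + 1)) => h; exists N.
have : (L <= Rabs L)%R by exact: Rle_abs.
have := h _; rewrite -/q => {}h; have {}h : (q * (Rabs L + 1) < d)%R by apply: h; lra.
nra.
Qed.

(** The two-dimensional form of Cousin's lemma: a property of rectangles that
    passes from the four quarters to the whole, and holds for all small
    rectangles around each point, holds for the whole rectangle.  Otherwise
    some sequence of nested bad quarters would shrink to a point. *)
Lemma rect_bisection (P : R -> R -> R -> R -> Prop) (a b c d : R) :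
  (a <= b)%R -> (c <= d)%R ->
  (forall a b c d, let m := ((a + b) / 2)%R in let n := ((c + d) / 2)%R in
    (a <= b)%R -> (c <= d)%R -> P a m c n -> P m b c n -> P a m n d -> P m b n d -> P a b c d) ->
  (forall z, in_rect a b c d z -> exists e, (0 < e)%R /\ forall a' b' c' d',
    (a <= a')%R -> (b' <= b)%R -> (c <= c')%R -> (d' <= d)%R -> in_rect a' b' c' d' z ->
    (b' - a' < e)%R -> (d' - c' < e)%R -> P a' b' c' d') ->
  P a b c d.
Proof.
move=> ab cd hP hloc; apply: NNPP => nP.
pose bad (r : R * R * R * R) := let '(a, b, c, d) := r in
  (a <= b)%R /\ (c <= d)%R /\ ~ P a b c d.
pose half (r r' : R * R * R * R) := let '(a, b, c, d) := r in let '(a', b', c', d') := r' in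
  ((a <= a') /\ (b' <= b) /\ (c <= c') /\ (d' <= d) /\
   b' - a' = (b - a) / 2 /\ d' - c' = (d - c) / 2)%R.
have step (r : {r | bad r}) : exists r' : {r | bad r}, half (sval r) (sval r').
  case: r => -[[[x y] z] t] /= [xy [zt nPr]].
  set m := ((x + y) / 2)%R; set n := ((z + t) / 2)%R.
  have sub (x' y' z' t' : R) : ~ P x' y' z' t' -> (x <= x' /\ y' <= y /\ z <= z' /\ t' <= t /\
      y' - x' = (y - x) / 2 /\ t' - z' = (t - z) / 2)%R ->
      exists r' : {r | bad r}, half (x, y, z, t) (sval r').
    move=> nP' [h1 [h2 [h3 [h4 [h5 h6]]]]].
    have hb : bad (x', y', z', t') by split; [lra | split; [lra | ]].
    by exists (exist _ _ hb).
  case: (classic (P x m z n)) => [P1|nP1]; last by apply: (sub _ _ _ _ nP1); rewrite /m /n; lra.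
  case: (classic (P m y z n)) => [P2|nP2]; last by apply: (sub _ _ _ _ nP2); rewrite /m /n; lra.
  case: (classic (P x m n t)) => [P3|nP3]; last by apply: (sub _ _ _ _ nP3); rewrite /m /n; lra.
  case: (classic (P m y n t)) => [P4|nP4]; last by apply: (sub _ _ _ _ nP4); rewrite /m /n; lra.
  by case: nPr; exact: hP.
pose next r := proj1_sig (constructive_indefinite_description _ (step r)).
have nextP r : half (sval r) (sval (next r)).
  exact: (proj2_sig (constructive_indefinite_description _ (step r))).
have hb : bad (a, b, c, d) by [].
pose r n := Nat.iter n next (exist _ _ hb).
pose an n := (sval (r n)).1.1.1; pose bn n := (sval (r n)).1.1.2.
pose cn n := (sval (r n)).1.2; pose dn n := (sval (r n)).2.
have badn n : bad (an n, bn n, cn n, dn n).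
  by rewrite /an /bn /cn /dn; case: (r n) => -[[[? ?] ?] ?].
have halfn n : half (an n, bn n, cn n, dn n) (an n.+1, bn n.+1, cn n.+1, dn n.+1).
  rewrite /an /bn /cn /dn; have := nextP (r n); rewrite -[next (r n)]/(r n.+1).
  by case: (sval (r n)) => -[[? ?] ?] ?; case: (sval (r n.+1)) => -[[? ?] ?] ?.
have [p1 hp1] : exists p : R, forall n, (an n <= p <= bn n)%R.
  apply: nested_intervals => n; have := halfn n; have := badn n; rewrite /bad /half; intuition.
have [p2 hp2] : exists p : R, forall n, (cn n <= p <= dn n)%R.
  apply: nested_intervals => n; have := halfn n; have := badn n; rewrite /bad /half; intuition.
have inn n : (a <= an n /\ bn n <= b /\ c <= cn n /\ dn n <= d /\
   bn n - an n = (b - a) * (1 / 2) ^ n /\ dn n - cn n = (d - c) * (1 / 2) ^ n)%R.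
  elim: n => [|n IH]; first by rewrite /an /bn /cn /dn /=; lra.
  by have := halfn n; rewrite /half /= => h; lra.
have [|e [e0 he]] := hloc (p1, p2).
  by have := hp1 O; have := hp2 O; rewrite /an /bn /cn /dn.
have [n hn] := half_pow_small (b - a + (d - c)) e0.
have q0 : (0 < (1 / 2) ^ n)%R by apply: pow_lt; lra.
have [_ [_ nPn]] := badn n; apply: nPn.
have [h1 [h2 [h3 [h4 [h5 h6]]]]] := inn n.
by apply: he => //; [rewrite h5 | rewrite h6]; nra.
Qed.

(** By bisection it suffices to bound the integral by [e] times the square of
    the half-perimeter, a bound that is additive over quarters.  It holds on
    small rectangles because there [u] is affine up to a small multiple of
    [x - z], and affine functions have integral zero. *)
Lemma Goursat u a b c d : cts_fun u -> (a <= b)%R -> (c <= d)%R ->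
  (forall z, in_rect a b c d z -> cdiff u z) -> bdint u a b c d = 0.
Proof.
move=> hu ab cd hd; apply: Cmod_eq_0.
apply: Rle_antisym; last exact: Cmod_ge_0.
apply: le_epsilon => e0 e00; rewrite Rplus_0_l.
pose S := (b - a + (d - c))%R.
have S0 : (0 <= S)%R by rewrite /S; lra.
pose e := (e0 / (S * S + 1))%R.
have e_gt0 : (0 < e)%R by apply: Rdiv_lt_0_compat => //; nra.
suff : (Cmod (bdint u a b c d) <= e * (S * S))%R.
  have : (e * (S * S + 1) = e0)%R by rewrite /e; field; nra.
  lra.
rewrite /S; apply: (@rect_bisection
  (fun a b c d => (Cmod (bdint u a b c d) <= e * ((b - a + (d - c)) * (b - a + (d - c))))%R)) => //.
  move=> a' b' c' d' m n ab' cd' h1 h2 h3 h4.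
  rewrite (bdint_split_h a' m b' c' d' hu) (bdint_split_v a' m c' n d' hu) (bdint_split_v m b' c' n d' hu).
  move: h1 h2 h3 h4; set x1 := bdint _ _ _ _ _; set x2 := bdint _ _ _ _ _.
  set x3 := bdint _ _ _ _ _; set x4 := bdint _ _ _ _ _ => h1 h2 h3 h4.
  have := Cmod_triangle (x1 + x3) (x2 + x4).
  have := Cmod_triangle x1 x3; have := Cmod_triangle x2 x4.
  move: h1 h2 h3 h4; rewrite /m /n; nra.
move=> z hz; have [s [hs us]] := hd z hz.
have [|r [r0 hr]] := hs (e / 4)%R; first lra.
exists (r / 2)%R; split; first lra.
move=> a' b' c' d' aa bb cc dd hz' hb' hd'.
pose v x := (s x - s z) * (x - z).
have vE x : v x = u x - u z - s z * (x - z) by rewrite /v us; ring.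
have cv : cts_fun v.
  move=> x; apply: (@cts_ext (fun x => u x - (u z + s z * (x - z)))).
    by move=> y; rewrite vE; ring.
  apply: cts_minus; first exact: hu.
  apply: cts_plus; first exact: cts_const.
  apply: cts_mult; first exact: cts_const.
  by apply: cts_minus; [exact: cts_id | exact: cts_const].
have -> : bdint u a' b' c' d' = bdint v a' b' c' d'.
  rewrite (@bdint_ext u (fun x => v x + ((u z - s z * z) + s z * x))); last first.
    by move=> x; rewrite vE; ring.
  rewrite bdint_plus // ?bdint_affine; first by ring.
  move=> x; apply: cts_plus; first exact: cts_const.
  by apply: cts_mult; [exact: cts_const | exact: cts_id].
move: hz' => [hz1 hz2].
have h := @Cmod_bdint_le v a' b' c' d' (e / 4 * (2 * (b' - a' + (d' - c')))) cv.
apply: Rle_trans (h _ _ _) _; [lra | lra | | lra].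
move=> x [hx1 hx2]; rewrite Cmod_mult.
have hxz : (Cmod (x - z) <= (b' - a') + (d' - c'))%R.
  apply: Rle_trans (Cmod_le_add _) _ => /=.
  by apply: Rplus_le_compat; apply: Rabs_le; lra.
apply: Rmult_le_compat; try exact: Cmod_ge_0.
- by left; apply: hr; lra.
- lra.
Qed.

Lemma eq_double_0 (w : C) : w = w + w -> w = 0.
Proof. by case: w => x y; rewrite /Cplus /RtoC /= => -[? ?]; congr pair; lra. Qed.

(** The part of a rectangle outside a small square around an exceptional point
    splits into four rectangles that avoid this point, and the integral along
    the small square tends to [0] by continuity. *)
Lemma bdint_holo_off S u : cts_fun u -> forall a b c d, (a <= b)%R -> (c <= d)%R ->
  (forall z, in_rect a b c d z -> ~ In z S -> cdiff u z) -> bdint u a b c d = 0.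
Proof.
move=> hu; elim: S => [|[p1 p2] S IH] a b c d ab cd hd; last set p : C := (p1, p2) in hd.
  by apply: Goursat => // z hz; apply: hd => // -[].
have avoid a' b' c' d' : (a <= a')%R -> (a' <= b')%R -> (b' <= b)%R -> (c <= c')%R ->
    (c' <= d')%R -> (d' <= d)%R -> ~ in_rect a' b' c' d' p -> bdint u a' b' c' d' = 0.
  move=> h1 h2 h3 h4 h5 h6 hp; apply: IH => // z hz hS; apply: hd.
    by move: hz; rewrite /in_rect; lra.
  by case=> // pz; apply: hp; rewrite pz.
case: (classic (in_rect a b c d p)) => [hp|]; last by apply: avoid => //; exact: Rle_refl.
have flat_h a' c' d' : bdint u a' a' c' d' = 0.
  exact: eq_double_0 (bdint_split_h a' a' a' c' d' hu).
have flat_v a' b' c' : bdint u a' b' c' c' = 0.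
  exact: eq_double_0 (bdint_split_v a' b' c' c' c' hu).
apply: Cmod_eq_0; apply: Rle_antisym; last exact: Cmod_ge_0.
apply: le_epsilon => e e0; rewrite Rplus_0_l.
have [r1 [r10 hr1]] := hu p _ Rlt_0_1.
set M := (Cmod (u p) + 1)%R.
have M0 : (0 < M)%R by have := Cmod_ge_0 (u p); rewrite /M; lra.
set r := Rmin (r1 / 3) (e / (8 * M)).
have r0 : (0 < r)%R by apply: Rmin_pos; [lra | apply: Rdiv_lt_0_compat; lra].
have rr1 : (r <= r1 / 3)%R := Rmin_l _ _.
have re : (8 * M * r <= e)%R.
  have := Rmin_r (r1 / 3) (e / (8 * M)); rewrite -/r => h.
  have -> : (e = 8 * M * (e / (8 * M)))%R by field; lra.
  by apply: Rmult_le_compat_l => //; lra.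
move: hp => [/= hp1 hp2].
(* The square of half-side r around p, clipped to the rectangle. *)
set a' := Rmax a (p1 - r); set b' := Rmin b (p1 + r).
set c' := Rmax c (p2 - r); set d' := Rmin d (p2 + r).
have ha' : (a <= a' <= p1)%R /\ (p1 - r <= a')%R /\ (a' = a \/ a' = p1 - r)%R.
  by rewrite /a' /Rmax; case: Rle_dec; lra.
have hb' : (p1 <= b' <= b)%R /\ (b' <= p1 + r)%R /\ (b' = b \/ b' = p1 + r)%R.
  by rewrite /b' /Rmin; case: Rle_dec; lra.
have hc' : (c <= c' <= p2)%R /\ (p2 - r <= c')%R /\ (c' = c \/ c' = p2 - r)%R.
  by rewrite /c' /Rmax; case: Rle_dec; lra.
have hd' : (p2 <= d' <= d)%R /\ (d' <= p2 + r)%R /\ (d' = d \/ d' = p2 + r)%R.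
  by rewrite /d' /Rmin; case: Rle_dec; lra.
have -> : bdint u a b c d = bdint u a' b' c' d'.
  rewrite (bdint_split_h a a' b c d hu) (bdint_split_h a' b' b c d hu).
  rewrite (bdint_split_v a' b' c c' d hu) (bdint_split_v a' b' c' d' d hu).
  have -> : bdint u a a' c d = 0.
    by case: (proj2 (proj2 ha')) => E; [rewrite E | apply: avoid; rewrite /in_rect /=; lra].
  have -> : bdint u b' b c d = 0.
    by case: (proj2 (proj2 hb')) => E; [rewrite E | apply: avoid; rewrite /in_rect /=; lra].
  have -> : bdint u a' b' c c' = 0.
    by case: (proj2 (proj2 hc')) => E; [rewrite E | apply: avoid; rewrite /in_rect /=; lra].
  have -> : bdint u a' b' d' d = 0.
    by case: (proj2 (proj2 hd')) => E; [rewrite E | apply: avoid; rewrite /in_rect /=; lra].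
  ring.
have h := @Cmod_bdint_le u a' b' c' d' M hu.
apply: Rle_trans (h _ _ _) _; [lra | lra | | ]; last first.
  apply: (Rle_trans _ (2 * M * (4 * r))); last lra.
  by apply: Rmult_le_compat_l; lra.
move=> z [hz1 hz2].
have hzp : (Cmod (z - (p1, p2)) < r1)%R.
  apply: Rle_lt_trans (Cmod_le_add _) _ => /=.
  have : (Rabs (z.1 + - p1) <= r)%R by apply: Rabs_le; lra.
  have : (Rabs (z.2 + - p2) <= r)%R by apply: Rabs_le; lra.
  lra.
have := hr1 z hzp; have := Cmod_triangle (u z - u (p1, p2)) (u (p1, p2)).
rewrite (_ : u z - u (p1, p2) + u (p1, p2) = u z); last by ring.
rewrite -/p /M; lra.
Qed.

(** By Riemann's theorem these are the entire functions; carrying the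
    exceptional points along instead of proving that theorem makes the class
    closed under slopes ([holo_slope]) at no cost. *)
Definition holo_off (S : list C) u : Prop := (forall z, cts u z) /\ forall z, ~ In z S -> cdiff u z.

Lemma Cminus_neq0 (x y : C) : x <> y -> x - y <> 0.
Proof.
move=> xy h; apply: xy; case: x y h => [x1 x2] [y1 y2].
by rewrite /Cminus /Cplus /Copp /RtoC /= => -[? ?]; congr pair; lra.
Qed.

Lemma cts_ext_off p u v z : z <> p -> (forall x, x <> p -> u x = v x) -> cts u z -> cts v z.
Proof.
move=> zp uv hu e e0; have [d [d0 hd]] := hu e e0.
have zp0 : (0 < Cmod (z - p))%R.
  by apply: (proj1 (Cmod_gt_0 _)); exact: Cminus_neq0.
exists (Rmin d (Cmod (z - p))); split; first exact: Rmin_pos.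
move=> x hx; rewrite -!uv //.
  by apply: hd; apply: Rlt_le_trans hx (Rmin_l _ _).
move=> xp; have := Rlt_le_trans _ _ _ hx (Rmin_r _ _).
by rewrite xp -(Cmod_opp (z - p)) (_ : - (z - p) = p - z); [lra | ring].
Qed.

Lemma Cmult_cancel_r (x y c : C) : c <> 0 -> x * c = y * c -> x = y.
Proof.
move=> c0 h; have -> : x = x * c / c by field.
by rewrite h; field.
Qed.

Lemma cts_quot p w v z : (forall x, v x * (x - p) = w x) -> z <> p -> cts w z -> cts v z.
Proof.
move=> vw zp hw; apply: (@cts_ext_off p (fun x => w x * / (x - p))) => //.
  by move=> x xp; rewrite -vw; field; exact: Cminus_neq0.
apply: cts_mult => //; apply: cts_inv; first exact: Cminus_neq0.
by apply: cts_minus; [exact: cts_id | exact: cts_const].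
Qed.

Lemma cdiff_quot p w v z : (forall x, v x * (x - p) = w x) -> z <> p -> cdiff w z -> cdiff v z.
Proof.
move=> vw zp hw; have cv := cts_quot vw zp (cdiff_cts hw); have zp0 := Cminus_neq0 zp.
case: hw => s [hs ws]; exists (fun x => (s x - v x) * / (z - p)); split.
  by apply: cts_mult; [exact: cts_minus | exact: cts_const].
move=> x; apply: (@Cmult_cancel_r _ _ (z - p)) => //.
rewrite (_ : (s x - v x) * / (z - p) * (x - z) * (z - p) = s x * (x - z) - v x * (x - z)); last by field.
by rewrite -ws -!vw; ring.
Qed.

Lemma holo_slope S u p s : holo_off S u -> slope u p s -> holo_off (p :: S) s.
Proof.
move=> [cu du] [cs us]; have us' x : s x * (x - p) = u x - u p by rewrite us.
split=> z.
  case: (classic (z = p)) => [-> //|zp].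
  by apply: (cts_quot us') => //; apply: cts_minus; [exact: cu | exact: cts_const].
move=> /= hz; apply: (cdiff_quot us').
  by move=> zp; apply: hz; left.
by apply: cdiff_minus; [apply: du => h; apply: hz; right | exact: cdiff_const].
Qed.

Lemma holo_pow S u n : holo_off S u -> holo_off S (fun x => Cpow (u x) n).
Proof. by move=> [cu du]; split=> z; [exact: cts_pow | move=> /du; exact: cdiff_pow]. Qed.

(** * The maximum principle *)

Lemma int_im_pos f a b : integrable f -> (a < b)%R ->
  (forall t, (a <= t <= b)%R -> continuous (fun t => (f t).2) t /\ (0 < (f t).2)%R) ->
  (0 < (int f a b).2)%R.
Proof.
move=> hf ab h.
have := RInt_correct (V := C_R_CompleteNormedModule) _ _ _ (hf a b).
move/(@is_RInt_fct_extend_snd R_NormedModule R_NormedModule) => H.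
rewrite -[X in (0 < X)%R](is_RInt_unique (V := R_CompleteNormedModule) _ _ _ _ H).
by apply: RInt_gt_0 => // t ht; [apply: (proj2 (h t _)); lra | exact: (proj1 (h t ht))].
Qed.

Lemma int_re_pos f a b : integrable f -> (a < b)%R ->
  (forall t, (a <= t <= b)%R -> continuous (fun t => (f t).1) t /\ (0 < (f t).1)%R) ->
  (0 < (int f a b).1)%R.
Proof.
move=> hf ab h.
have := RInt_correct (V := C_R_CompleteNormedModule) _ _ _ (hf a b).
move/(@is_RInt_fct_extend_fst R_NormedModule R_NormedModule) => H.
rewrite -[X in (0 < X)%R](is_RInt_unique (V := R_CompleteNormedModule) _ _ _ _ H).
by apply: RInt_gt_0 => // t ht; [apply: (proj2 (h t _)); lra | exact: (proj1 (h t ht))].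
Qed.

Lemma continuous_re (g : R -> C) u t :
  (forall t1 t2, Cmod (g t1 - g t2) <= Rabs (t1 - t2))%R -> cts_fun u ->
  continuous (fun t => (u (g t)).1) t.
Proof.
move=> hg hu; apply: (continuous_comp (fun t => u (g t)) (fun z : R * R => z.1)).
  exact: continuous_cts.
exact: continuous_fst.
Qed.

Lemma continuous_im (g : R -> C) u t :
  (forall t1 t2, Cmod (g t1 - g t2) <= Rabs (t1 - t2))%R -> cts_fun u ->
  continuous (fun t => (u (g t)).2) t.
Proof.
move=> hg hu; apply: (continuous_comp (fun t => u (g t)) (fun z : R * R => z.2)).
  exact: continuous_cts.
exact: continuous_snd.
Qed.

(** The function [v] is a small perturbation of [1 / x].  The imaginary part of
    [1 / x] is positive below the real axis and negative above it, its real
    part is positive on the right and negative on the left; a relative error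
    of at most [D / (4 T)] does not change these signs when [x] is at distance at
    least [D] from the corresponding axis and its other coordinate is at most
    [2 T]. *)
Lemma near_inverse_sign (v x s : C) (D T d : R) :
  v * x = 1 - s -> (Cmod s <= d)%R -> (0 < D <= T)%R -> (d = D / (4 * T))%R ->
  ((x.2 <= - D -> Rabs x.1 <= 2 * T -> 0 < v.2) /\ (D <= x.2 -> Rabs x.1 <= 2 * T -> v.2 < 0) /\
   (D <= x.1 -> Rabs x.2 <= 2 * T -> 0 < v.1) /\ (x.1 <= - D -> Rabs x.2 <= 2 * T -> v.1 < 0))%R.
Proof.
case: v x s => [v1 v2] [x1 x2] [s1 s2] /=.
rewrite /Cmult /Cminus /Cplus /Copp /RtoC /= => -[e1 e2] hs hD hd.
have := Rle_trans _ _ _ (Rmax_Cmod _) hs => /= hm.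
have hs1 := Rle_trans _ _ _ (Rmax_l _ _) hm; have hs2 := Rle_trans _ _ _ (Rmax_r _ _) hm.
have {hm hs hs1} [a1 a2] : (s1 <= d /\ - d <= s1)%R by move: hs1; rewrite /Rabs; case: Rcase_abs; lra.
have {hs2} [b1 b2] : (s2 <= d /\ - d <= s2)%R by move: hs2; rewrite /Rabs; case: Rcase_abs; lra.
have d0 : (0 < d)%R by rewrite hd; apply: Rdiv_lt_0_compat; lra.
have dT : (d * (4 * T) = D)%R by rewrite hd; field; lra.
have d4 : (d <= 1 / 4)%R by nra.
have E1 : (v1 * (x1 * x1 + x2 * x2) = (1 - s1) * x1 - s2 * x2)%R.
  rewrite (_ : ((1 - s1) * x1 - s2 * x2 = (1 + - s1) * x1 + (0 + - s2) * x2)%R); last ring.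
  by rewrite -e1 -e2; ring.
have E2 : (v2 * (x1 * x1 + x2 * x2) = - (1 - s1) * x2 - s2 * x1)%R.
  rewrite (_ : (- (1 - s1) * x2 - s2 * x1 = - (1 + - s1) * x2 + (0 + - s2) * x1)%R); last ring.
  by rewrite -e1 -e2; ring.
have small y : (Rabs y <= 2 * T)%R -> (- (D / 2) <= s2 * y <= D / 2)%R.
  rewrite /Rabs; case: Rcase_abs => ? ?; nra.
have pos w N : (0 <= N)%R -> (0 < w * N)%R -> (0 < w)%R.
  by move=> N0 h; case: (Rle_lt_dec w 0) => // w0; nra.
split; [|split; [|split]] => h /small hy.
- apply: (pos _ (x1 * x1 + x2 * x2)%R); first nra.
  rewrite E2; nra.
- suff : (0 < - v2)%R by lra.
  apply: (pos _ (x1 * x1 + x2 * x2)%R); first nra.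
  rewrite (_ : - v2 * (x1 * x1 + x2 * x2) = - (v2 * (x1 * x1 + x2 * x2)))%R; last ring.
  rewrite E2; nra.
- apply: (pos _ (x1 * x1 + x2 * x2)%R); first nra.
  rewrite E1; nra.
- suff : (0 < - v1)%R by lra.
  apply: (pos _ (x1 * x1 + x2 * x2)%R); first nra.
  rewrite (_ : - v1 * (x1 * x1 + x2 * x2) = - (v1 * (x1 * x1 + x2 * x2)))%R; last ring.
  rewrite E1; nra.
Qed.

Lemma Cpow_neq0 z n : z <> 0 -> Cpow z n <> 0.
Proof.
move=> z0; elim: n => [|n IH] /=; last exact: Cmult_neq_0.
by move=> h; have := Cmod_1; rewrite h Cmod_0; lra.
Qed.

(** Suppose that [|u z0|] exceeds [M], which bounds [|u|] on the boundary of the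
    square of half-side [T].  Let [k] be the slope at [z0] of a high power [u^n].
    Its boundary integral is zero.  But [- k x / (u z0)^n] equals
    [(1 - (u x / u z0)^n) / (x - z0)], which on the boundary is so close to
    [1 / (x - z0)] that the contribution of each of the four sides to the
    imaginary part of the integral is positive. *)
Lemma maximum_principle S u T M z0 : holo_off S u -> (0 < T)%R ->
  (forall z, (T <= Cmod z <= 2 * T)%R -> (Cmod (u z) <= M)%R) ->
  (Cmod z0 < T)%R -> ~ In z0 S -> (Cmod (u z0) <= M)%R.
Proof.
move=> hu T0 hM hz0 nS; apply: Rnot_lt_le => hlt.
have M0 : (0 <= M)%R.
  apply: Rle_trans (Cmod_ge_0 _) (hM (RtoC T) _); rewrite Cmod_R Rabs_pos_eq; lra.
set A := Cmod (u z0) in hlt.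
set D := (T - Cmod z0)%R; have Cz0 := Cmod_ge_0 z0.
set d := (D / (4 * T))%R.
have d0 : (0 < d)%R by apply: Rdiv_lt_0_compat; rewrite /D; lra.
have [n hn] : exists n, ((M / A) ^ n < d)%R.
  have [|N hN] := pow_lt_1_zero (M / A) _ d d0.
  - rewrite Rabs_pos_eq; first by apply/Rlt_div_l; lra.
    by apply: Rdiv_le_0_compat; lra.
  by exists N; apply: Rle_lt_trans (Rle_abs _) (hN N (le_n N)).
pose U x := Cpow (u x) n.
have Uz0 : U z0 <> 0.
  by apply: Cpow_neq0; apply: (proj2 (Cmod_gt_0 _)); rewrite -/A; lra.
have hU : holo_off S U by exact: holo_pow.
have [k hk] := proj2 hU z0 nS.
pose V x := - k x * / U z0.
have hV : holo_off (z0 :: S) V.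
  have [ck dk] := holo_slope hU hk; split=> z.
    by apply: cts_mult; [exact: cts_opp | exact: cts_const].
  by move=> hz; apply: cdiff_mult; [apply: cdiff_opp; exact: dk | exact: cdiff_const].
have VE x : V x * (x - z0) = 1 - U x / U z0.
  rewrite /V (_ : - k x * / U z0 * (x - z0) = - (k x * (x - z0)) * / U z0); last by ring.
  by rewrite -(proj2 hk); field.
clearbody V.
have sM x : (T <= Cmod x <= 2 * T)%R -> (Cmod (U x / U z0) <= d)%R.
  move=> hx; rewrite Cmod_div // /U !Cmod_pow -/A.
  have -> : (Cmod (u x) ^ n / A ^ n = (Cmod (u x) / A) ^ n)%R.
    by rewrite /Rdiv Rpow_mult_distr pow_inv.
  apply: Rle_trans (Rlt_le _ _ hn); apply: pow_incr; split.
    by apply: Rdiv_le_0_compat; [exact: Cmod_ge_0 | lra].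
  by apply: Rmult_le_compat_r; [left; apply: Rinv_0_lt_compat; lra | exact: hM].
have hD : (0 < D <= T)%R by rewrite /D; lra.
have cV : cts_fun V := proj1 hV.
have E : bdint V (- T) T (- T) T = 0.
  by apply: (@bdint_holo_off (z0 :: S)) => //; [lra | lra | move=> z _; exact: (proj2 hV)].
have {hz0} [hz1 hz2] : (- (T - D) <= z0.1 <= T - D /\ - (T - D) <= z0.2 <= T - D)%R.
  have h := Rmax_Cmod z0; have := Rle_trans _ _ _ (Rmax_l _ _) h.
  have := Rle_trans _ _ _ (Rmax_r _ _) h.
  by rewrite /D /Rabs; do 2!case: Rcase_abs; lra.
have onb (a b : R) : (Rabs a = T /\ - T <= b <= T \/ Rabs b = T /\ - T <= a <= T)%R ->
    (T <= Cmod (a, b) <= 2 * T)%R.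
  move=> h; split.
    apply: Rle_trans (Rmax_Cmod _) => /=; case: h => -[-> _]; [exact: Rmax_l | exact: Rmax_r].
  apply: Rle_trans (Cmod_le_add _) _ => /=.
  by case: h => -[-> /Rabs_le]; lra.
have absT : (Rabs T = T)%R by rewrite Rabs_pos_eq; lra.
have absnT : (Rabs (- T) = T)%R by rewrite Rabs_Ropp.
have sgn (a b : R) (h : (Rabs a = T /\ - T <= b <= T \/ Rabs b = T /\ - T <= a <= T)%R) :=
  near_inverse_sign (VE (a, b)) (sM (a, b) (onb a b h)) hD (erefl d).
have pos1 : (0 < (int (fun t => (V (t, (- T)%R) - V (t, T))%C) (- T) T).2)%R.
  apply: int_im_pos; [by apply: integrable_minus; exact: integrable_h | lra | move=> t ht; split].
    apply: (@continuous_minus R_UniformSpace R_AbsRing R_NormedModule).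
      exact: (@continuous_im (fun t => (t, (- T)%R))) (Cmod_hline _) cV.
    exact: (@continuous_im (fun t => (t, T))) (Cmod_hline _) cV.
  have at2 : (Rabs (t + - z0.1) <= 2 * T)%R by apply: Rabs_le; lra.
  have [h1 _] := sgn t (- T)%R (or_intror (conj absnT ht)).
  have [_ [h2 _]] := sgn t T (or_intror (conj absT ht)).
  move: h1 h2 => /=; set p := (V _).2; set q := (V _).2 => h1 h2.
  have : (0 < p)%R by apply: h1; lra.
  have : (q < 0)%R by apply: h2; lra.
  lra.
have pos2 : (0 < (int (fun t => (V (T, t) - V ((- T)%R, t))%C) (- T) T).1)%R.
  apply: int_re_pos; [by apply: integrable_minus; exact: integrable_v | lra | move=> t ht; split].
    apply: (@continuous_minus R_UniformSpace R_AbsRing R_NormedModule).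
      exact: (@continuous_re (fun t => (T, t))) (Cmod_vline _) cV.
    exact: (@continuous_re (fun t => ((- T)%R, t))) (Cmod_vline _) cV.
  have at2 : (Rabs (t + - z0.2) <= 2 * T)%R by apply: Rabs_le; lra.
  have [_ [_ [h1 _]]] := sgn T t (or_introl (conj absT ht)).
  have [_ [_ [_ h2]]] := sgn (- T)%R t (or_introl (conj absnT ht)).
  move: h1 h2 => /=; set p := (V _).1; set q := (V _).1 => h1 h2.
  have : (0 < p)%R by apply: h1; lra.
  have : (q < 0)%R by apply: h2; lra.
  lra.
have : ((bdint V (- T) T (- T) T).2 = 0)%R by rewrite E.
rewrite /bdint; move: pos1 pos2; case: (int _ _ _) => a1 a2; case: (int _ _ _) => b1 b2.
rewrite /Ci /Cmult /Cplus /=; lra.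
Qed.

(** * Many zeros, flat zeros and growth *)

Lemma infinite_ball (E : list C) z d : (0 < d)%R -> exists x, (Cmod (x - z) < d)%R /\ ~ In x E.
Proof.
move=> d0; apply: NNPP => h.
pose pt n := z + RtoC (d / INR n.+2).
have pt_inj : FinFun.Injective pt.
  move=> n m; rewrite /pt => e.
  have {e} : RtoC (d / INR n.+2) = RtoC (d / INR m.+2).
    have -> : RtoC (d / INR n.+2) = z + RtoC (d / INR n.+2) - z by ring.
    by rewrite e; ring.
  move=> /RtoC_inj e.
  have hn := lt_0_INR n.+2 (Nat.lt_0_succ _); have hm := lt_0_INR m.+2 (Nat.lt_0_succ _).
  have : (INR n.+2 = INR m.+2)%R.
    have -> : (INR n.+2 = d / (d / INR n.+2))%R by field; lra.
    by rewrite e; field; lra.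
  by move/INR_eq => [].
have inE n : In (pt n) E.
  apply: NNPP => nE; apply: h; exists (pt n); split=> //.
  rewrite /pt (_ : z + RtoC (d / INR n.+2) - z = RtoC (d / INR n.+2)); last by ring.
  have hn := lt_0_INR n.+1 (Nat.lt_0_succ _).
  rewrite Cmod_R Rabs_pos_eq; rewrite S_INR; last by apply: Rdiv_le_0_compat; lra.
  by apply/Rlt_div_l; nra.
have := NoDup_incl_length (FinFun.Injective_map_NoDup pt_inj (seq_NoDup (S (length E)) O)).
move/(_ E); rewrite length_map length_seq => H.
have : (S (length E) <= length E)%coq_nat by apply: H => x /in_map_iff [n [<- _]].
exact: Nat.nle_succ_diag_l.
Qed.

Lemma eq_off_finite E u v : cts_fun u -> cts_fun v -> (forall z, ~ In z E -> u z = v z) ->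
  forall z, u z = v z.
Proof.
move=> cu cv uv z; apply: NNPP => /Cminus_neq0 h.
have h0 := proj1 (Cmod_gt_0 _) h.
have [d [d0 hd]] := cts_minus (cu z) (cv z) h0.
have [x [xz xE]] := infinite_ball E z d0.
have := hd x xz; rewrite (uv x xE).
rewrite (_ : v x - v x - (u z - v z) = - (u z - v z)); last by ring.
rewrite Cmod_opp; lra.
Qed.

(** Dividing [u] by [x - m] for one zero [m] after the other multiplies the
    bound by at most [1 / (3 R / 4)] on [|x| >= R], and multiplying back at [z]
    costs at most [R / 2]; this gives a factor [2 / 3] for each zero. *)
Lemma Schwarz_many_zeros R : (0 < R)%R -> forall Z S u M, holo_off S u -> NoDup Z ->
  (forall m, In m Z -> (Cmod m <= R / 4)%R /\ u m = 0 /\ ~ In m S) ->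
  (forall z, (R <= Cmod z <= 2 * R)%R -> (Cmod (u z) <= M)%R) ->
  forall z, (Cmod z <= R / 4)%R -> ~ In z S -> ~ In z Z ->
  (Cmod (u z) <= M * (2 / 3) ^ length Z)%R.
Proof.
move=> R0; elim=> [|m Z IH] S u M hu hZ hz hM z zR zS zZ.
  rewrite /= Rmult_1_r; apply: (maximum_principle hu R0) => //; lra.
have [mR [um mS]] : (Cmod m <= R / 4)%R /\ u m = 0 /\ ~ In m S by apply: hz; left.
have [s hs] := proj2 hu m mS.
have us x : u x = s x * (x - m) by rewrite -(proj2 hs) um; ring.
have [mZ hZ'] := proj1 (NoDup_cons_iff m Z) hZ.
have zm : z <> m by move=> e; apply: zZ; left.
have dist x y : (Cmod x - Cmod y <= Cmod (x - y))%R.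
  by have := Cmod_triangle (x - y) y; rewrite (_ : x - y + y = x); [lra | ring].
have H := IH (m :: S) s (M / (3 / 4 * R))%R (holo_slope hu hs) hZ'.
have {H}H : (Cmod (s z) <= M / (3 / 4 * R) * (2 / 3) ^ length Z)%R.
  apply: H => //.
  - move=> m' hm'; have [h1 [h2 h3]] : (Cmod m' <= R / 4)%R /\ u m' = 0 /\ ~ In m' S.
      by apply: hz; right.
    have m'm : m' <> m by move=> e; rewrite e in hm'.
    split=> //; split; last by case=> // e; apply: m'm.
    apply: (@Cmult_cancel_r _ _ (m' - m)); first exact: Cminus_neq0.
    by rewrite -us h2; ring.
  - move=> x hx; have := hM x hx; rewrite us Cmod_mult => h.
    apply/Rle_div_r; first lra.
    apply: Rle_trans h; apply: Rmult_le_compat_l; first exact: Cmod_ge_0.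
    by have := dist x m; lra.
  - by case=> [e|//]; apply: zm.
  - by move=> h; apply: zZ; right.
have M0 : (0 <= M)%R.
  apply: Rle_trans (Cmod_ge_0 _) (hM (RtoC R) _); rewrite Cmod_R Rabs_pos_eq; lra.
rewrite us Cmod_mult /=.
have -> : (M * (2 / 3 * (2 / 3) ^ length Z) = M / (3 / 4 * R) * (2 / 3) ^ length Z * (R / 2))%R.
  by field; lra.
apply: Rmult_le_compat => //; try exact: Cmod_ge_0.
have := Cmod_triangle z (- m); rewrite Cmod_opp /Cminus; lra.
Qed.

(** The quotient of [u] by any power [k] of [x - p] is continuous at [p], so the
    maximum principle on a large square applies to it.  The square is chosen
    such that its boundary is at least twice as far from [p] as [z] is, which
    yields [|u z| <= M / 2^k]. *)
Lemma flat_zero u p : holo_off nil u ->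
  (forall k, exists B r, (0 < r)%R /\
     forall x, (0 < Cmod (x - p) < r)%R -> (Cmod (u x) <= B * Cmod (x - p) ^ k)%R) ->
  (forall T, exists M, forall x, (Cmod x <= T)%R -> (Cmod (u x) <= M)%R) ->
  forall z, u z = 0.
Proof.
move=> hu flat bnd.
have xp0 x : x <> p -> (0 < Cmod (x - p))%R.
  by move=> h; apply: (proj1 (Cmod_gt_0 _)); exact: Cminus_neq0.
(* The inverse of 0 is 0 here, so v k vanishes at p, its continuous value there. *)
pose v k x := u x * / Cpow (x - p) k.
have vflat k : exists B r, (0 < r)%R /\
    forall x, (0 < Cmod (x - p) < r)%R -> (Cmod (v k x) <= B * Cmod (x - p))%R.
  have [B [r [r0 h]]] := flat k.+1; exists B, r; split=> // x hx.
  have xk : Cpow (x - p) k <> 0.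
    by apply: Cpow_neq0; apply: (proj2 (Cmod_gt_0 _)); lra.
  rewrite /v Cmod_mult Cmod_inv // Cmod_pow.
  have c0 : (0 < Cmod (x - p) ^ k)%R by apply: pow_lt; lra.
  apply/Rle_div_l => //; apply: Rle_trans (h x hx) _ => /=; right; ring.
have small w : cts w p -> (exists B r, (0 < r)%R /\
    forall x, (0 < Cmod (x - p) < r)%R -> (Cmod (w x) <= B * Cmod (x - p))%R) -> w p = 0.
  move=> cw [B [r [r0 h]]]; apply: Cmod_eq_0; apply: Rle_antisym; last exact: Cmod_ge_0.
  apply: le_epsilon => e e0; rewrite Rplus_0_l.
  have [|d [d0 hd]] := cw (e / 2)%R; first lra.
  have B0 := Rabs_pos B.
  set t := Rmin (Rmin r d) (e / (2 * (Rabs B + 1))).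
  have t0 : (0 < t)%R.
    by apply: Rmin_pos; [exact: Rmin_pos | apply: Rdiv_lt_0_compat; lra].
  have [x [xt xp]] := infinite_ball (p :: nil) p t0.
  have {}xp := xp0 x (fun e => xp (or_introl (esym e))).
  have tr : (t <= r)%R by apply: Rle_trans (Rmin_l _ _) (Rmin_l _ _).
  have td : (t <= d)%R by apply: Rle_trans (Rmin_l _ _) (Rmin_r _ _).
  have te : (t * (2 * (Rabs B + 1)) <= e)%R.
    have : (t <= e / (2 * (Rabs B + 1)))%R by exact: Rmin_r.
    by move/Rle_div_r; apply; lra.
  have h1 : (Cmod (w x - w p) < e / 2)%R by apply: hd; lra.
  have h2 : (Cmod (w x) <= B * Cmod (x - p))%R by apply: h; lra.
  have BB := Rle_abs B.
  have := Cmod_triangle (w x) (- (w x - w p)); rewrite Cmod_opp.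
  rewrite (_ : w x + - (w x - w p) = w p); [nra | ring].
have up : u p = 0.
  apply: small; first exact: (proj1 hu).
  have [B [r [r0 h]]] := vflat O; exists B, r; split=> // x hx.
  by have := h x hx; rewrite /v /= (_ : u x * / 1 = u x); [ | field; exact: C1_nz].
have vp k : v k p = 0 by rewrite /v up; ring.
have vS k x : v k.+1 x * (x - p) = v k x.
  case: (classic (x = p)) => [->|xp]; first by rewrite !vp; ring.
  have x0 := Cminus_neq0 xp.
  by rewrite /v /=; field; split=> //; exact: Cpow_neq0.
have hv k : holo_off (p :: nil) (v k).
  elim: k => [|k [IH1 IH2]].
    split=> [z|z _]; last first.
      apply: (@cdiff_ext u); last exact: (proj2 hu).
      by move=> x; rewrite /v /=; field; exact: C1_nz.
    apply: (@cts_ext u); last exact: (proj1 hu).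
    by move=> x; rewrite /v /=; field; exact: C1_nz.
  split=> z.
    case: (classic (z = p)) => [->|zp]; last exact: (cts_quot (vS k)).
    move=> e e0; have [B [r [r0 h]]] := vflat k.+1; have B0 := Rabs_pos B.
    exists (Rmin r (e / (Rabs B + 1))); split.
      by apply: Rmin_pos => //; apply: Rdiv_lt_0_compat; lra.
    move=> x hx; rewrite vp (_ : v k.+1 x - 0 = v k.+1 x); last by ring.
    case: (classic (x = p)) => [->|/xp0 x0]; first by rewrite vp Cmod_0.
    have h1 := Rlt_le_trans _ _ _ hx (Rmin_l _ _).
    have h2 : (Cmod (x - p) * (Rabs B + 1) < e)%R.
      by apply/Rlt_div_r; [lra | exact: Rlt_le_trans hx (Rmin_r _ _)].
    have h3 : (Cmod (v k.+1 x) <= B * Cmod (x - p))%R by apply: h; lra.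
    have := Rle_abs B; nra.
  move=> zp; apply: (cdiff_quot (vS k)); last exact: IH2.
  by move=> e; apply: zp; left.
move=> z; case: (classic (z = p)) => [-> //|zp].
have zp0 := xp0 z zp; have Cz := Cmod_ge_0 z; have Cp := Cmod_ge_0 p.
set T := (1 + Cmod p + 2 * (Cmod z + Cmod p))%R.
have [M hM] := bnd (2 * T)%R.
have hzp : (Cmod (z - p) <= Cmod z + Cmod p)%R.
  by have := Cmod_triangle z (- p); rewrite Cmod_opp.
have key k : (Cmod (u z) <= M * (1 / 2) ^ k)%R.
  have q0 : (0 < (2 * Cmod (z - p)) ^ k)%R by apply: pow_lt; lra.
  have : (Cmod (v k z) <= M / (2 * Cmod (z - p)) ^ k)%R.
    apply: (@maximum_principle (p :: nil) (v k) T) => //; first by rewrite /T; lra.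
    - move=> x hx; have xp : (2 * Cmod (z - p) <= Cmod (x - p))%R.
        have := Cmod_triangle (x - p) p; rewrite (_ : x - p + p = x); last by ring.
        by rewrite /T in hx; lra.
      have xk : Cpow (x - p) k <> 0.
        by apply: Cpow_neq0; apply: (proj2 (Cmod_gt_0 _)); lra.
      rewrite /v Cmod_mult Cmod_inv // Cmod_pow.
      apply: Rmult_le_compat; [exact: Cmod_ge_0 | | apply: hM; lra |].
        by left; apply: Rinv_0_lt_compat; apply: pow_lt; lra.
      by apply: Rinv_le_contravar => //; apply: pow_incr; lra.
    - by rewrite /T; lra.
    - by case=> // e; apply: zp.
  have zk : Cpow (z - p) k <> 0 by apply: Cpow_neq0; exact: Cminus_neq0.
  rewrite /v Cmod_mult Cmod_inv // Cmod_pow => /Rle_div_l h.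
  have c0 : (0 < Cmod (z - p) ^ k)%R by apply: pow_lt.
  apply: Rle_trans (h c0) _; right.
  have -> : (1 / 2 = / 2)%R by field.
  rewrite Rpow_mult_distr pow_inv; field; split; last by lra.
  by apply: pow_nonzero; lra.
apply: Cmod_eq_0; apply: Rle_antisym; last exact: Cmod_ge_0.
apply: le_epsilon => e e0; rewrite Rplus_0_l.
by have [n hn] := half_pow_small M e0; have := key n; lra.
Qed.

(** Induction on [k], spending half of the geometric decay, the factor
    [sqrt q ^ n], on one power of [n + 1]. *)
Lemma pow_geom_bounded k : forall q, (0 < q < 1)%R -> exists B, (0 <= B)%R /\
  forall n, ((INR n + 1) ^ k * q ^ n <= B)%R.
Proof.
elim: k => [|k IH] q hq.
  exists 1%R; split=> [|n]; first lra.
  rewrite /= Rmult_1_l -(pow1 n); apply: pow_incr; lra.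
set t := sqrt q.
have tt : (t * t = q)%R by apply: sqrt_sqrt; lra.
have ht : (0 < t < 1)%R.
  split; first by apply: sqrt_lt_R0; lra.
  by rewrite -sqrt_1; apply: sqrt_lt_1; lra.
have [B [B0 hB]] := IH t ht.
(* Bernoulli for 1 + h = 1 / t bounds (n + 1) t^n. *)
set h := (/ t - 1)%R.
have h0 : (0 < h)%R.
  have := Rinv_0_lt_compat t (proj1 ht); have := Rinv_l t; rewrite /h; nra.
exists (B * (1 + / h))%R; split.
  by apply: Rmult_le_pos => //; have := Rinv_0_lt_compat h h0; lra.
move=> n; have n0 := pos_INR n; have tn : (0 < t ^ n)%R by apply: pow_lt; lra.
have lin : ((INR n + 1) * t ^ n <= 1 + / h)%R.
  have tn' : (t ^ n * (1 + h) ^ n = 1)%R.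
    by rewrite -Rpow_mult_distr (_ : t * (1 + h) = 1)%R ?pow1 // /h; field; lra.
  have p1 := poly n h h0.
  have : (INR n + 1 <= (1 + / h) * (1 + h) ^ n)%R.
    apply: (Rle_trans _ ((1 + / h) * (1 + INR n * h))).
      have i0 := Rinv_0_lt_compat h h0.
      have -> : ((1 + / h) * (1 + INR n * h) = INR n + 1 + (/ h + INR n * h))%R by field; lra.
      nra.
    apply: Rmult_le_compat_l => //; have := Rinv_0_lt_compat h h0; lra.
  move=> H; have {}H := Rmult_le_compat_r _ _ _ (Rlt_le _ _ tn) H.
  have -> : (1 + / h = (1 + / h) * (t ^ n * (1 + h) ^ n))%R by rewrite tn' Rmult_1_r.
  lra.
rewrite -tt Rpow_mult_distr /=.
have -> : ((INR n + 1) * (INR n + 1) ^ k * (t ^ n * t ^ n)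
   = ((INR n + 1) ^ k * t ^ n) * ((INR n + 1) * t ^ n))%R by ring.
apply: Rmult_le_compat => //; first by apply: Rmult_le_pos; [apply: pow_le; lra | lra].
by apply: Rmult_le_pos; lra.
Qed.

(** For [w] near [p] the function [x |-> g x w - g 0 w] vanishes at the
    multiples of [tau w], of which there are [n] in a fixed disc if [n] is of
    the order of [1 / |w - p|].  Hence [G w = g z w - g 0 w] is bounded by a
    multiple of [(2 / 3)^n], and [G] is flat at [p]. *)
Lemma shear_periodic_const (g : C -> C -> C) (tau : C -> C) (p : C) (K rho : R) :
  (forall w z, cdiff (fun z => g z w) z) -> (forall z w, cdiff (fun w => g z w) w) ->
  (forall T, exists M, forall z w, (Cmod z <= T)%R -> (Cmod w <= T)%R -> (Cmod (g z w) <= M)%R) ->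
  (0 < K)%R -> (0 < rho)%R ->
  (forall w, (0 < Cmod (w - p) < rho)%R -> tau w <> 0 /\ (Cmod (tau w) <= K * Cmod (w - p))%R) ->
  (forall z w, g (z + tau w) w = g z w) ->
  forall z w, g z w = g 0 w.
Proof.
move=> gz gw bnd K0 rho0 htau per z.
pose G w := g z w - g 0 w.
have hG : holo_off nil G.
  have dG w : cdiff G w by apply: cdiff_minus; exact: gw.
  by split=> w //; exact: cdiff_cts.
suff G0 : forall w, G w = 0.
  move=> w; have -> : g z w = G w + g 0 w by rewrite /G; ring.
  by rewrite G0; ring.
apply: (@flat_zero G p) => //; last first.
  move=> T; have [M hM] := bnd (Rmax T (Cmod z)); exists (M + M)%R => w hw.
  have h1 : (Cmod (g z w) <= M)%R.
    by apply: hM; [exact: Rmax_r | apply: Rle_trans hw (Rmax_l _ _)].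
  have h2 : (Cmod (g 0 w) <= M)%R.
    apply: hM; last by apply: Rle_trans hw (Rmax_l _ _).
    by rewrite Cmod_0; apply: Rle_trans (Cmod_ge_0 z) (Rmax_r _ _).
  by have := Cmod_triangle (g z w) (- g 0 w); rewrite Cmod_opp /G /Cminus; lra.
have Cz := Cmod_ge_0 z; have Cp := Cmod_ge_0 p.
set R0 := (4 * Cmod z + 1)%R.
have R00 : (0 < R0)%R by rewrite /R0; lra.
have [M hM] := bnd (2 * R0 + Cmod p + rho)%R.
have M0 : (0 <= M)%R.
  by apply: Rle_trans (Cmod_ge_0 _) (hM 0 0 _ _); rewrite Cmod_0; lra.
have perN n x w : g (x + RtoC (INR n) * tau w) w = g x w.
  elim: n => [|n IH]; first by rewrite (_ : x + RtoC (INR O) * tau w = x) //=; ring.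
  rewrite S_INR RtoC_plus (_ : _ + _ = x + RtoC (INR n) * tau w + tau w); last by ring.
  by rewrite per IH.
(* Schwarz with the zeros i tau(w), i < n, on the disc of radius R0 >= 4 |z|. *)
have key n w : (0 < Cmod (w - p) < rho)%R -> (INR n * (K * Cmod (w - p)) <= R0 / 4)%R ->
    (Cmod (G w) <= 2 * M * (2 / 3) ^ n)%R.
  move=> hw hn; have [t0 tK] := htau w hw.
  have wT : (Cmod w <= 2 * R0 + Cmod p + rho)%R.
    by have := Cmod_triangle (w - p) p; rewrite (_ : w - p + p = w); [lra | ring].
  pose h x := g x w - g 0 w.
  pose Z := map (fun i => RtoC (INR i) * tau w) (List.seq O n).
  have hz m : In m Z -> (Cmod m <= R0 / 4)%R /\ h m = 0.
    move=> /in_map_iff [i [<- /in_seq [_ hi]]]; split; last first.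
      rewrite /h; have := perN i 0 w; rewrite (_ : 0 + _ = RtoC (INR i) * tau w) => [->|]; ring.
    rewrite Cmod_mult Cmod_R Rabs_pos_eq; last exact: pos_INR.
    apply: Rle_trans hn; apply: Rmult_le_compat => //; [exact: pos_INR | exact: Cmod_ge_0 |].
    by apply: le_INR; apply: Nat.lt_le_incl.
  have q0 : (0 <= 2 * M * (2 / 3) ^ n)%R by apply: Rmult_le_pos; [lra | apply: pow_le; lra].
  case: (classic (In z Z)) => [/hz [_ e]|nz]; first by rewrite /G -/(h z) e Cmod_0.
  have -> : n = length Z by rewrite /Z length_map length_seq.
  apply: (@Schwarz_many_zeros R0 R00 Z nil h) => //.
  - have dh x : cdiff h x by apply: cdiff_minus; [exact: gz | exact: cdiff_const].
    by split=> x //; exact: cdiff_cts.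
  - apply: FinFun.Injective_map_NoDup; last exact: seq_NoDup.
    by move=> i j /(Cmult_cancel_r t0) /RtoC_inj /INR_eq.
  - by move=> m hm; have [? ?] := hz m hm; split=> //; split.
  - move=> x hx.
    have h1 : (Cmod (g x w) <= M)%R by apply: hM => //; lra.
    have h2 : (Cmod (g 0 w) <= M)%R by apply: hM => //; rewrite Cmod_0; lra.
    by have := Cmod_triangle (g x w) (- g 0 w); rewrite Cmod_opp /h /Cminus; lra.
  - by rewrite /R0; lra.
move=> k; have [|B [B0 hB]] := @pow_geom_bounded k (2 / 3); first lra.
set c := (R0 / (4 * K))%R.
have c0 : (0 < c)%R by apply: Rdiv_lt_0_compat; lra.
exists (2 * M * B / c ^ k)%R, rho; split=> // w hw.
set d := Cmod (w - p) in hw *.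
(* The largest number of zeros allowed by key; then 1 / (n + 1) < d / c. *)
have [|n [hn1 hn2]] := nfloor_ex (c / d)%R; first by apply: Rdiv_le_0_compat; lra.
have := key n w hw; rewrite -/d => H.
have {H} : (Cmod (G w) <= 2 * M * (2 / 3) ^ n)%R.
  apply: H; have : (INR n * d <= c)%R by move/Rle_div_r: hn1; apply; lra.
  have e : (c * (4 * K) = R0)%R by rewrite /c; field; lra.
  move=> h; have := Rmult_le_compat_r (4 * K) _ _ _ h; lra.
move=> h; apply: Rle_trans h _.
have ck : (0 < c ^ k)%R by apply: pow_lt.
have n0 := pos_INR n.
have nk : (0 < (INR n + 1) ^ k)%R by apply: pow_lt; lra.
have dk : (c ^ k <= (INR n + 1) ^ k * d ^ k)%R.
  rewrite -Rpow_mult_distr; apply: pow_incr; split; first lra.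
  by left; move/Rlt_div_l: hn2; apply; lra.
have e1 : ((2 / 3) ^ n <= B / (INR n + 1) ^ k)%R.
  by apply/Rle_div_r => //; rewrite Rmult_comm.
have e2 : (B / (INR n + 1) ^ k <= B * d ^ k / c ^ k)%R.
  apply/Rle_div_l => //.
  have -> : (B * d ^ k / c ^ k * (INR n + 1) ^ k = B * ((INR n + 1) ^ k * d ^ k) / c ^ k)%R.
    by field; lra.
  by apply/Rle_div_r => //; apply: Rmult_le_compat_l.
have -> : (2 * M * B / c ^ k * d ^ k = 2 * M * (B * d ^ k / c ^ k))%R by field; lra.
by apply: Rmult_le_compat_l; lra.
Qed.

(** Let [w1] be the zero of [g].  Since [h] is bounded on the unit disc,
    [|g x| >= 1] for large [x], so [v x = (x - w1) / g x] has linear growth.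
    Its slope is then bounded near infinity, the slope of the slope tends to
    [0] at infinity and vanishes by the maximum principle: [v] is affine.  An affine [v] with
    [x - w1 = g x * v x] and [g] injective must be constant. *)
Lemma entire_bijection_affine (g h : C -> C) :
  (forall z, cdiff g z) -> (forall z, cdiff h z) ->
  (forall z, h (g z) = z) -> (forall z, g (h z) = z) ->
  (exists B, forall z, (Cmod z <= 1)%R -> (Cmod (h z) <= B)%R) ->
  exists a b, forall z, g z = a * z + b.
Proof.
move=> dg dh hg gh [B hB]; set w1 := h 0.
have gw1 : g w1 = 0 by rewrite /w1 gh.
have [f hf] := dg w1; have [ps hps] := dh 0.
have gE x : g x = f x * (x - w1) by rewrite -(proj2 hf) gw1; ring.
have hol_g : holo_off nil g by split=> z //; exact: cdiff_cts.
have hol_h : holo_off nil h by split=> z //; exact: cdiff_cts.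
have [cf df] := holo_slope hol_g hf; have [cps _] := holo_slope hol_h hps.
have pf x : ps (g x) * f x = 1.
  apply: (@eq_off_finite (w1 :: nil) (fun x => ps (g x) * f x) (fun=> 1)).
  - by move=> z; apply: cts_mult => //; apply: cts_comp; [exact: cdiff_cts | exact: cps].
  - by move=> z; exact: cts_const.
  move=> z zE; have zw : z <> w1 by move=> e; apply: zE; left.
  apply: (@Cmult_cancel_r _ _ (z - w1)); first exact: Cminus_neq0.
  rewrite -Cmult_assoc -gE.
  have := proj2 hps (g z); rewrite hg -/w1 => e.
  rewrite (_ : ps (g z) * g z = ps (g z) * (g z - 0)); last by ring.
  by rewrite -e; ring.
(* By the chain rule the derivative of g does not vanish at w1 either. *)
have f0 x : f x <> 0.
  move=> e; have := pf x; rewrite e (_ : ps (g x) * 0 = 0); last by ring.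
  by move=> e1; apply: C1_nz.
pose v x := / f x.
have hv : holo_off (w1 :: nil) v.
  split=> z; first by apply: cts_inv.
  by move=> hz; apply: cdiff_inv => //; exact: df.
have vg x : v x * g x = x - w1 by rewrite /v gE; field.
have vbig x : (B < Cmod x)%R -> (Cmod (v x) <= Cmod x + Cmod w1)%R.
  move=> hx; have g1 : (1 < Cmod (g x))%R.
    by apply: Rnot_le_lt => /hB; rewrite hg; lra.
  have := Cmod_triangle x (- w1); rewrite Cmod_opp -/(x - w1) -vg Cmod_mult.
  have := Cmod_ge_0 (v x); nra.
have [p [_ pE]] := infinite_ball (w1 :: nil) 0 Rlt_0_1.
have [s1 hs1] := proj2 hv p pE; have hol1 := holo_slope hv hs1.
have [p2 [_ p2E]] := infinite_ball (p :: w1 :: nil) 0 Rlt_0_1.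
have [s2 hs2] := proj2 hol1 p2 p2E; have hol2 := holo_slope hol1 hs2.
have P0 := Cmod_ge_0 p; have P2 := Cmod_ge_0 p2; have W1 := Cmod_ge_0 w1.
have V0 := Cmod_ge_0 (v p); have S0 := Cmod_ge_0 (s1 p2).
pose T0 := (1 + Rabs B + 2 * Cmod p + 2 * Cmod p2 + Cmod w1 + Cmod (v p))%R.
have BB := Rle_abs B; have AB := Rabs_pos B.
have dist x y : (Cmod x - Cmod y <= Cmod (x - y))%R.
  by have := Cmod_triangle (x - y) y; rewrite (_ : x - y + y = x); [lra | ring].
pose A := (2 * (6 + Cmod (s1 p2)))%R.
have s2big T x : (T0 <= T)%R -> (T <= Cmod x <= 2 * T)%R -> (Cmod (s2 x) <= A / T)%R.
  rewrite /T0 => hT hx.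
  have s1x : (Cmod (s1 x) <= 6)%R.
    have e : Cmod (s1 x * (x - p)) = Cmod (v x - v p) by rewrite -(proj2 hs1).
    rewrite Cmod_mult in e.
    have := vbig x; have := Cmod_triangle (v x) (- v p); rewrite Cmod_opp -/(v x - v p) -e.
    have := dist x p; have := Cmod_ge_0 (s1 x) => a1 a2 a3 a4.
    have {}a4 := a4 ltac:(lra).
    apply: Rnot_lt_le => a5; nra.
  have e : Cmod (s2 x * (x - p2)) = Cmod (s1 x - s1 p2) by rewrite -(proj2 hs2).
  rewrite Cmod_mult in e.
  have := Cmod_triangle (s1 x) (- s1 p2); rewrite Cmod_opp -/(s1 x - s1 p2) -e.
  have := dist x p2; have := Cmod_ge_0 (s2 x) => a1 a2 a3.
  apply/Rle_div_r; first lra.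
  rewrite /A; nra.
have s20 z : ~ In z (p2 :: p :: w1 :: nil) -> s2 z = 0.
  move=> zE; apply: Cmod_eq_0; apply: Rle_antisym; last exact: Cmod_ge_0.
  apply: le_epsilon => e e0; rewrite Rplus_0_l.
  have A0 : (0 < A)%R by rewrite /A; lra.
  have Cz := Cmod_ge_0 z.
  have Ae : (0 < A / e)%R by exact: Rdiv_lt_0_compat.
  set T := (T0 + Cmod z + 1 + A / e)%R.
  have hT0 : (1 <= T0)%R by rewrite /T0; lra.
  apply: (Rle_trans _ (A / T)).
    apply: (@maximum_principle _ s2 T (A / T) z hol2) => //; try by rewrite /T; lra.
    by move=> x; apply: s2big; rewrite /T; lra.
  apply/Rle_div_l; first by rewrite /T; lra.
  have -> : A = (e * (A / e))%R by field; lra.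
  by apply: Rmult_le_compat_l; rewrite /T; lra.
set c := s1 p2.
have lin x : x - w1 = g x * (v p + c * (x - p)).
  apply: (@eq_off_finite (p2 :: p :: w1 :: nil) (fun x => x - w1) (fun x => g x * (v p + c * (x - p)))).
  - by move=> z; apply: cts_minus; [exact: cts_id | exact: cts_const].
  - move=> z; apply: cts_mult; first exact: cdiff_cts.
    apply: cts_plus; first exact: cts_const.
    apply: cts_mult; first exact: cts_const.
    by apply: cts_minus; [exact: cts_id | exact: cts_const].
  move=> z zE; rewrite -vg.
  have -> : v z = v p + s1 z * (z - p) by rewrite -(proj2 hs1); ring.
  have -> : s1 z = c.
    have -> : s1 z = s1 p2 + s2 z * (z - p2) by rewrite -(proj2 hs2); ring.
    by rewrite s20 // /c; ring.
  ring.
set e := v p - c * p.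
have {}lin x : x - w1 = g x * (e + c * x) by rewrite lin /e; ring.
case: (classic (c = 0)) => [c0|c0].
  have e0 : e <> 0.
    move=> e0; have := lin (w1 + 1); rewrite e0 c0.
    rewrite (_ : w1 + 1 - w1 = 1); last by ring.
    by rewrite (_ : _ * _ = 0); [exact: C1_nz | ring].
  exists (/ e), (- w1 / e) => x; apply: (@Cmult_cancel_r _ _ e) => //.
  have := lin x; rewrite c0 (_ : e + 0 * x = e); last by ring.
  by move=> <-; field.
have w1E : - e / c = w1.
  have := lin (- e / c); rewrite (_ : e + c * (- e / c) = 0); last by field.
  move=> E; have -> : - e / c = (- e / c - w1) + w1 by ring.
  by rewrite E; ring.
have gc x : x <> w1 -> g x = / c.
  move=> xw; have xw0 := Cminus_neq0 xw; apply: (@Cmult_cancel_r _ _ (x - w1)) => //.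
  have := lin x; have -> : e = - (c * w1) by rewrite -w1E; field.
  move=> E; apply: (@Cmult_cancel_r _ _ c) => //.
  rewrite (_ : g x * (x - w1) * c = g x * (- (c * w1) + c * x)); last by ring.
  by rewrite -E; field.
have ne (t : R) : t <> 0%R -> w1 + RtoC t <> w1.
  move=> t0 E; apply: t0; apply: RtoC_inj.
  have -> : RtoC t = w1 + RtoC t - w1 by ring.
  by rewrite E; ring.
have := hg (w1 + 1); rewrite gc; last by apply: ne; lra.
rewrite -(gc (w1 + 2)); last by apply: ne; lra.
rewrite hg => E; exfalso; have : RtoC 1 = 0; last exact: C1_nz.
have -> : RtoC 1 = w1 + 2 - (w1 + 1) by ring.
by rewrite E; ring.
Qed.

End ComplexAnalysis.

From mathcomp Require Import ring.
Import Order.TTheory GRing.Theory Num.Theory.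
Import numFieldNormedType.Exports.
Local Open Scope classical_set_scope.
Local Open Scope ring_scope.

(** * Transfer to the complex numbers over the real field *)

Notation R := Rdefinitions.R.
Notation CC := Coquelicot.Complex.C.
Notation Cmod := Coquelicot.Complex.Cmod.

Definition to_pair (z : C) : CC := (complex.Re z, complex.Im z).
Definition of_pair (w : CC) : C := (w.1 +i* w.2)%C.

Lemma to_pairK : cancel to_pair of_pair. Proof. by case. Qed.
Lemma of_pairK : cancel of_pair to_pair. Proof. by case. Qed.
Lemma to_pairD z w : to_pair (z + w) = Coquelicot.Complex.Cplus (to_pair z) (to_pair w).
Proof. by case: z w => [a b] [c d]. Qed.
Lemma to_pairN z : to_pair (- z) = Coquelicot.Complex.Copp (to_pair z).
Proof. by case: z => [a b]. Qed.
Lemma to_pairB z w : to_pair (z - w) = Coquelicot.Complex.Cminus (to_pair z) (to_pair w).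
Proof. by rewrite to_pairD to_pairN. Qed.
Lemma to_pairM z w : to_pair (z * w) = Coquelicot.Complex.Cmult (to_pair z) (to_pair w).
Proof. by case: z w => [a b] [c d]. Qed.
Lemma normCE (z : C) : `|z| = (Cmod (to_pair z))%:C%C.
Proof.
rewrite normc_def /Coquelicot.Complex.Cmod RsqrtE /=.
by rewrite !expr2 !RmultE !RplusE !R1E !mulr1.
Qed.

Lemma cts_of_continuous (v : C -> C) (z : C) :
  {for z, continuous v} -> ComplexAnalysis.cts (to_pair \o v \o of_pair) (to_pair z).
Proof.
move=> /cvgrPdist_lt hv e /RltP e0.
have /hv : 0 < (e%:C)%C :> C by rewrite ltcR.
move=> /nbhs_ballP [d /= d0 hd].
move: d0; case: d hd => d d' hd; rewrite ltcE /= => /andP[/eqP d'0 d0].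
exists d; split; first exact/RltP.
move=> x /RltP hx.
have : ball z (d +i* d')%C (of_pair x).
  rewrite -ball_normE /ball_ /= -normrN opprB normCE to_pairB of_pairK ltcE /= hx andbT -d'0.
  by rewrite eqxx.
move/hd; rewrite -normrN opprB normCE to_pairB ltcR => /RltP.
by rewrite /comp to_pairK.
Qed.

Lemma cdiff_of_differentiable (v : C -> C) (z : C) :
  differentiable v z -> ComplexAnalysis.cdiff (to_pair \o v \o of_pair) (to_pair z).
Proof.
move=> /derivable1_diffP dv.
pose s (x : C) : C := if x == z then 'D_1 v z else (v x - v z) / (x - z).
exists (to_pair \o s \o of_pair); split; last first.
  move=> x; rewrite /comp to_pairK -to_pairB -[x in Coquelicot.Complex.Cminus x _]of_pairK -to_pairB -to_pairM.
  congr to_pair; rewrite /s; case: eqVneq => [->|xz]; first by rewrite !subrr mulr0.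
  by rewrite divfK // subr_eq0.
suff cs : s x @[x --> z] --> s z by exact: (cts_of_continuous cs).
have : (fun h => h^-1 *: (v (h *: 1 + z) - v z)) @ 0^' --> 'D_1 v z by exact: dv.
move=> /cvgrPdist_lt H; apply/(cvgrPdist_lt (F := nbhs z)) => e e0.
have := H e e0 => /nbhs_ballP [d /= d0 hd]; apply/nbhs_ballP; exists d => //= x hx.
rewrite /s eqxx; case: eqVneq => [_|xz]; first by rewrite subrr normr0.
have := hd (x - z) _ _; rewrite /= {1}[_ *: 1]mulr1 subrK mulrC; apply.
  by move: hx; rewrite -!ball_normE /ball_ /= sub0r normrN distrC.
by rewrite subr_eq0.
Qed.

(** * Bounds on bidiscs *)

Lemma continuous_complex_pair : continuous (fun p : R * R => (p.1 +i* p.2)%C : C).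
Proof.
move=> [a b]; apply/(cvgrPdist_lt (F := nbhs (a, b))) => -[e e']; rewrite ltcE /= => /andP[/eqP-> e0].
have e20 : 0 < e / 2 by rewrite divr_gt0.
have c1 : (fun q : R * R => q.1) @ nbhs (a, b) --> a by exact: cvg_fst.
have c2 : (fun q : R * R => q.2) @ nbhs (a, b) --> b by exact: cvg_snd.
move/(@cvgrPdist_lt R R^o): c1 => /(_ _ e20) c1; move/(@cvgrPdist_lt R R^o): c2 => /(_ _ e20) c2.
near=> q.
rewrite normCE ltcE /= eqxx /=.
have h1 : `|a - q.1| < e / 2 by near: q.
have h2 : `|b - q.2| < e / 2 by near: q.
have /RleP h := ComplexAnalysis.Cmod_le_add (to_pair ((a +i* b)%C - (q.1 +i* q.2)%C)).
apply: le_lt_trans h _.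
by rewrite RplusE !RabsE [ltRHS]splitr ltrD.
Unshelve. all: by end_near.
Qed.

Lemma continuous_Cmod : continuous (fun z : C => Cmod (to_pair z) : R).
Proof.
move=> z; apply/(@cvgrPdist_lt R R^o _ (nbhs z)) => e e0.
have : (fun x : C => x) @ nbhs z --> z by exact: cvg_id.
move/cvgrPdist_lt => /(_ e%:C%C); rewrite ltcR => /(_ e0); apply: filterS => x.
rewrite normCE ltcR; apply: le_lt_trans.
have := ler_dist_dist z x; rewrite !normCE lecR -rmorphB.
rewrite -[X in Cmod X]/(Coquelicot.Complex.RtoC (Cmod (to_pair z) - Cmod (to_pair x))).
by rewrite Coquelicot.Complex.Cmod_R RabsE.
Qed.

(** The bidisc lies in the image of a product of four real segments, which is
    compact. *)
Lemma bounded_on_bidisc (g : C2 -> C) (T : R) : continuous g ->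
  exists M : R, forall z w, (Rdefinitions.Rle (Cmod (to_pair z)) T) ->
    (Rdefinitions.Rle (Cmod (to_pair w)) T) -> Rdefinitions.Rle (Cmod (to_pair (g (z, w)))) M.
Proof.
move=> cg.
pose K := `[- T, T]%classic : set R.
pose emb (p : (R * R) * (R * R)) : C2 := ((p.1.1 +i* p.1.2)%C, (p.2.1 +i* p.2.2)%C).
have cemb : continuous emb.
  move=> p.
  have c1 : (fun p : (R * R) * (R * R) => (p.1.1 +i* p.1.2)%C : C) x @[x --> p]
      --> ((p.1.1 +i* p.1.2)%C : C).
    apply: (@continuous_comp _ _ _ fst (fun p : R * R => (p.1 +i* p.2)%C : C)).
      by case: p => a b; exact: cvg_fst.
    exact: continuous_complex_pair.
  have c2 : (fun p : (R * R) * (R * R) => (p.2.1 +i* p.2.2)%C : C) x @[x --> p]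
      --> ((p.2.1 +i* p.2.2)%C : C).
    apply: (@continuous_comp _ _ _ snd (fun p : R * R => (p.1 +i* p.2)%C : C)).
      by case: p {c1} => a b; exact: cvg_snd.
    exact: continuous_complex_pair.
  exact: (cvg_pair c1 c2).
pose N p := Cmod (to_pair (g (emb p))).
have cN : continuous N.
  move=> p; apply: (@continuous_comp _ _ _ (g \o emb) (fun z : C => Cmod (to_pair z) : R)).
    apply: continuous_comp; [exact: cemb | exact: cg].
  exact: continuous_Cmod.
have cK : compact K by exact: segment_compact.
have cKK := compact_setX (compact_setX cK cK) (compact_setX cK cK).
have := continuous_compact (continuous_subspaceT cN) cKK.
move/(@compact_bounded R R^o) => [M [_ hM]].
have MM : M < `|M| + 1 by rewrite (le_lt_trans (ler_norm M)) // ltrDl.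
exists (`|M| + 1) => z w hz hw.
have inK (x : C) : Rdefinitions.Rle (Cmod (to_pair x)) T ->
    K (complex.Re x) /\ K (complex.Im x).
  move=> hx.
  have h := RIneq.Rle_trans _ _ _ (Coquelicot.Complex.Rmax_Cmod (to_pair x)) hx.
  have /RleP := RIneq.Rle_trans _ _ _ (Rbasic_fun.Rmax_l _ _) h.
  have /RleP := RIneq.Rle_trans _ _ _ (Rbasic_fun.Rmax_r _ _) h.
  by rewrite !RabsE !ler_norml /K /= !in_itv /= => -> ->.
have [z1 z2] := inK z hz; have [w1 w2] := inK w hw.
have := hM _ MM (N ((complex.Re z, complex.Im z), (complex.Re w, complex.Im w))).
have E (x : C) : (complex.Re x +i* complex.Im x)%C = x by case: x.
rewrite /= /N /emb /= !E => H; apply/RleP; apply: le_trans (ler_norm _) (H _).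
exists ((complex.Re z, complex.Im z), (complex.Re w, complex.Im w)) => //=.
by rewrite !E.
Qed.

(** * Functions invariant under a polynomial shear *)

Lemma differentiable_horner (p : {poly C}) (z : C) : differentiable (fun x : C => p.[x] : C) z.
Proof.
elim/poly_ind: p => [|p c IH].
  by under eq_fun do rewrite horner0; exact: differentiable_cst.
under eq_fun do rewrite hornerMXaddC.
apply: differentiableD; last exact: differentiable_cst.
exact: differentiableM.
Qed.

Lemma differentiable_slice1 (g : C2 -> C) z w :
  differentiable g (z, w) -> differentiable (fun x : C => g (x, w)) z.
Proof.
by move=> hg; apply: (@differentiable_comp _ _ _ _ (fun x : C => (x, w) : C2) g).
Qed.

Lemma differentiable_slice2 (g : C2 -> C) z w :
  differentiable g (z, w) -> differentiable (fun x : C => g (z, x)) w.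
Proof.
by move=> hg; apply: (@differentiable_comp _ _ _ _ (fun x : C => (z, x) : C2) g).
Qed.

Lemma fst_is_linear : linear (fst : C2 -> C). Proof. by []. Qed.
Lemma snd_is_linear : linear (snd : C2 -> C). Proof. by []. Qed.
HB.instance Definition _ := GRing.isLinear.Build C C2 C *:%R fst fst_is_linear.
HB.instance Definition _ := GRing.isLinear.Build C C2 C *:%R snd snd_is_linear.

Lemma differentiable_fst (x : C2) : differentiable (fst : C2 -> C) x.
Proof. by apply: linear_differentiable => -[a b]; exact: cvg_fst. Qed.

Lemma differentiable_snd (x : C2) : differentiable (snd : C2 -> C) x.
Proof. by apply: linear_differentiable => -[a b]; exact: cvg_snd. Qed.

Lemma to_pair_inj : injective to_pair. Proof. exact: can_inj to_pairK. Qed.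

(** The abstract argument is [shear_periodic_const].  Here a zero [p] of [Q] is
    supplied, near which [Q] is bounded by a multiple of [w - p] (the slope of
    [Q] at [p] is continuous) and has no other zero (the cofactor of the full
    power of [X - p] does not vanish at [p]). *)
Lemma shear_invariant (g : C2 -> C) (Q : {poly C}) :
  (forall x, differentiable g x) -> (1 < size Q)%N ->
  (forall z w, g (z + Q.[w], w) = g (z, w)) -> forall z w, g (z, w) = g (0, w).
Proof.
move=> dg sQ per z w; apply: to_pair_inj.
have [p rQ] : exists p, root Q p by apply/closed_rootP; rewrite neq_ltn sQ orbT.
have Q0 : Q != 0 by rewrite -size_poly_gt0; case: (size Q) sQ.
have [m [P]] := multiplicity_XsubC Q p; rewrite Q0 /= => nP QE.
have [s [hs Qs]] := cdiff_of_differentiable (differentiable_horner Q p).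
have cP := ComplexAnalysis.cdiff_cts (cdiff_of_differentiable (differentiable_horner P p)).
have [d1 [d10 hd1]] := hs _ RIneq.Rlt_0_1.
have P0 : Rdefinitions.Rlt (0 : R) (Cmod (to_pair P.[p])).
  apply: (proj1 (Coquelicot.Complex.Cmod_gt_0 _)) => h; apply/negP: nP; rewrite negbK.
  by apply/eqP; apply: to_pair_inj; rewrite h.
have [|d2 [d20 hd2]] := cP (Cmod (to_pair P.[p])); first by [].
have rho0 := Rbasic_fun.Rmin_pos _ _ d10 d20.
set rho := Rbasic_fun.Rmin d1 d2 in rho0.
pose K := Cmod (s (to_pair p)) + 1.
have K0 : 0 < K.
  by rewrite /K ltr_wpDl //; apply/RleP; exact: Coquelicot.Complex.Cmod_ge_0.
have := @ComplexAnalysis.shear_periodic_const (fun a b => to_pair (g (of_pair a, of_pair b)))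
  (fun b => to_pair Q.[of_pair b]) (to_pair p) K rho.
move=> /(_ _ _ _ _ rho0 _ _ (to_pair z) (to_pair w)); rewrite !to_pairK; apply.
- move=> b a; rewrite -[a]of_pairK.
  apply: (cdiff_of_differentiable (v := fun x => g (x, of_pair b))).
  exact: differentiable_slice1.
- move=> a b; rewrite -[b]of_pairK.
  apply: (cdiff_of_differentiable (v := fun x => g (of_pair a, x))).
  exact: differentiable_slice2.
- move=> T; have [|M hM] := @bounded_on_bidisc g T.
    by move=> x; exact: differentiable_continuous.
  by exists M => a b ha hb; apply: hM; rewrite of_pairK.
- exact/RltP.
- move=> b [/RltP b0 hb].
  have hb1 := RIneq.Rlt_le_trans _ _ _ hb (Rbasic_fun.Rmin_l _ _).
  have hb2 := RIneq.Rlt_le_trans _ _ _ hb (Rbasic_fun.Rmin_r _ _).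
  split.
    move=> h; have : to_pair Q.[of_pair b] = to_pair 0 by exact: h.
    move/to_pair_inj; rewrite QE hornerM horner_exp hornerXsubC => /eqP.
    rewrite mulf_eq0 expf_eq0 => /orP[/eqP Pb|/andP[_ /eqP bp]].
      have := hd2 b hb2; rewrite /= to_pairK Pb -to_pairB sub0r to_pairN Coquelicot.Complex.Cmod_opp.
      by move/RIneq.Rlt_irrefl.
    by move: b0; rewrite -(of_pairK b) -to_pairB bp Coquelicot.Complex.Cmod_0 ltxx.
  have := Qs b; rewrite /= to_pairK (eqP rQ).
  move=> E; have -> : to_pair Q.[of_pair b] = Coquelicot.Complex.Cmult (s b) (Coquelicot.Complex.Cminus b (to_pair p)).
    by rewrite -E -to_pairB subr0.
  rewrite Coquelicot.Complex.Cmod_mult.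
  apply: RIneq.Rmult_le_compat_r; first exact: Coquelicot.Complex.Cmod_ge_0.
  apply/RleP; rewrite /K.
  have /RltP h := hd1 b hb1.
  have /RleP := Coquelicot.Complex.Cmod_triangle (s (to_pair p)) (Coquelicot.Complex.Cminus (s b) (s (to_pair p))).
  rewrite (_ : Coquelicot.Complex.Cplus _ _ = s b); last first.
    by rewrite -(of_pairK (s b)) -(of_pairK (s _)) -to_pairB -to_pairD subrKC.
  by move/le_trans; apply; rewrite RplusE lerD2l ltW.
- move=> a b; rewrite -(per (of_pair a)); congr (to_pair (g (_, _))).
  by rewrite -{1}(of_pairK a) -to_pairD to_pairK.
Qed.

Lemma biholomorphism_affine (g h : C -> C) :
  (forall z, differentiable g z) -> (forall z, differentiable h z) ->
  cancel g h -> cancel h g -> exists a b, forall z, g z = a * z + b.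
Proof.
move=> dg dh gh hg.
have [|||||a [b E]] := @ComplexAnalysis.entire_bijection_affine (to_pair \o g \o of_pair) (to_pair \o h \o of_pair).
- by move=> z; rewrite -[z]of_pairK; exact: cdiff_of_differentiable.
- by move=> z; rewrite -[z]of_pairK; exact: cdiff_of_differentiable.
- by move=> z; rewrite /= to_pairK gh of_pairK.
- by move=> z; rewrite /= to_pairK hg of_pairK.
- have [|M hM] := @bounded_on_bidisc (h \o fst) (1 : R).
    move=> x; apply: differentiable_continuous.
    by apply: differentiable_comp; [exact: differentiable_fst | exact: dh].
  by exists M => z hz; apply: (hM (of_pair z) (of_pair z)); rewrite of_pairK.
exists (of_pair a), (of_pair b) => z; apply: to_pair_inj.
by have := E (to_pair z); rewrite /= to_pairK => ->; rewrite to_pairD to_pairM !of_pairK.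
Qed.

(** * Elementary maps with entire coefficients *)

Definition elementary_map (a : C) (s : C -> C) (c d : C) : C2 -> C2 :=
  fun x => (a * x.1 + s x.2, c * x.2 + d).

Lemma elementary_holomorphic a s c d :
  (forall w, differentiable s w) -> holomorphic (elementary_map a s c d).
Proof.
move=> ds x; have d1 := differentiable_fst x; have d2 := differentiable_snd x.
apply: (@differentiable_pair _ _ _ _ (fun x : C2 => a * x.1 + s x.2 : C) (fun x : C2 => c * x.2 + d : C)).
  apply: differentiableD; last by apply: (differentiable_comp d2); exact: ds.
  by apply: differentiableM => //; exact: differentiable_cst.
apply: differentiableD; last exact: differentiable_cst.
by apply: differentiableM => //; exact: differentiable_cst.
Qed.

Lemma elementary_inverse a s c d : a != 0 -> c != 0 -> (forall w, differentiable s w) ->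
  inverse_biholomorphisms (elementary_map a s c d)
    (elementary_map a^-1 (fun w => - a^-1 * s (c^-1 * w - c^-1 * d)) c^-1 (- (c^-1 * d))).
Proof.
move=> a0 c0 ds; split.
- move=> [z w]; rewrite /elementary_map /=.
  have -> : c^-1 * (c * w + d) - c^-1 * d = w by field.
  by congr pair; set t := s w; field.
- move=> [z w]; rewrite /elementary_map /=; congr pair; last by field.
  by set t := s _; field.
- exact: elementary_holomorphic.
- apply: elementary_holomorphic => w.
  apply: differentiableM; first exact: differentiable_cst.
  apply: (@differentiable_comp _ _ _ _ (fun w : C => c^-1 * w - c^-1 * d : C) s); last exact: ds.
  apply: differentiableB; last exact: differentiable_cst.
  by apply: differentiableM => //; exact: differentiable_cst.
Qed.

(** The polynomial [w^mu q(w^r)] is multiplied by [beta^mu] when [w] is replaced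
    by [beta w], so that the contributions of the [n] steps are all equal. *)
Lemma F_map_iter r mu beta q n z w : beta ^+ r = 1 ->
  iter n (F_map r mu beta q) (z, w) =
  (beta ^+ (mu * n) * (z + n%:R * (w ^+ mu * q.[w ^+ r])), beta ^+ n * w).
Proof.
move=> br; elim: n => [|n IH]; first by rewrite muln0 !expr0 !mul1r mul0r addr0.
rewrite iterS IH /F_map.
have -> : (beta ^+ n * w) ^+ r = w ^+ r by rewrite exprMn exprAC br expr1n mul1r.
have -> : (beta ^+ n * w) ^+ mu = beta ^+ (mu * n) * w ^+ mu by rewrite exprMn exprAC exprM.
congr pair; last by rewrite exprS mulrA.
rewrite mulnS exprD.
by rewrite -[n.+1%:R]natr1; ring.
Qed.

Definition F_poly r mu (q : {poly C}) : {poly C} := 'X^mu * (q \Po 'X^r).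

Lemma F_polyE r mu q w : (F_poly r mu q).[w] = w ^+ mu * q.[w ^+ r].
Proof. by rewrite hornerM horner_comp !hornerXn. Qed.

Lemma size_F_poly r k mu (q : {poly C}) : (1 <= r)%N -> (1 <= k)%N -> size q = k.+1 ->
  (1 < size (F_poly r mu q))%N.
Proof.
move=> r1 k1 sq; have := size_comp_poly q 'X^r; rewrite sq size_polyXn /= => E.
have kr : (0 < k * r)%N by rewrite muln_gt0 k1 r1.
have P0 : q \Po 'X^r != 0 by apply: contraTneq kr => P0; rewrite -E P0 size_poly0.
rewrite size_monicM ?monicXn // size_polyXn /=.
by case: (size _) E kr => [|s] /= <- // s0; rewrite (leq_trans _ (leq_addl _ _)).
Qed.

Lemma F_map_elementary r mu beta q : F_map r mu beta q =1
  elementary_map (beta ^+ mu) (fun w => beta ^+ mu * (F_poly r mu q).[w]) beta 0.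
Proof. by move=> [z w]; rewrite /elementary_map /= F_polyE addr0 mulrDr. Qed.

(** The function [(x, y) |-> y u(x) - x u(y)] is invariant under
    [(x, y) |-> (x + y, y)] and vanishes for [x = 0]. *)
Lemma additive_linear (u : C -> C) : (forall z, differentiable u z) ->
  {morph u : x y / x + y} -> forall z, u z = u 1 * z.
Proof.
move=> du uD z.
have u0 : u 0 = 0 by apply: (addrI (u 0)); rewrite -uD !addr0.
pose g (x : C2) : C := x.2 * u x.1 - x.1 * u x.2.
have := @shear_invariant g 'X _ _ _ z 1; rewrite /g /= u0 !mul1r mul0r subr0.
move=> H; apply/eqP; rewrite -subr_eq0 mulrC; apply/eqP; apply: H.
- move=> x; have d1 := differentiable_fst x; have d2 := differentiable_snd x.
  by apply: differentiableB; apply: differentiableM => //; apply: differentiable_comp.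
- by rewrite size_polyX.
- by move=> x y; rewrite hornerX uD; ring.
Qed.

Lemma continuous_eq_off (u v : C -> C) z : continuous u -> continuous v ->
  (forall x, x != z -> u x = v x) -> u =1 v.
Proof.
move=> cu cv uv x; apply: to_pair_inj; rewrite -[x]to_pairK.
apply: (@ComplexAnalysis.eq_off_finite (to_pair z :: nil) (to_pair \o u \o of_pair) (to_pair \o v \o of_pair)).
- by move=> y; rewrite -[y]of_pairK; apply: cts_of_continuous; exact: cu.
- by move=> y; rewrite -[y]of_pairK; apply: cts_of_continuous; exact: cv.
- move=> y yz; rewrite /= uv //; apply/eqP => e; apply: yz; left.
  by rewrite -e of_pairK.
Qed.

Lemma continuous_horner (p : {poly C}) : continuous (fun w : C => p.[w] : C).
Proof. by move=> w; exact: differentiable_continuous (differentiable_horner p w). Qed.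

(** A zero of [p1] is a zero of [p2]; dividing both by the same linear factor
    keeps the relation off this zero, and at the zero by continuity. *)
Lemma continuous_polynomial_quotient (a : C -> C) (p1 p2 : {poly C}) :
  continuous a -> p1 != 0 -> (forall w, a w * p1.[w] = p2.[w]) ->
  exists t : {poly C}, forall w, a w = t.[w].
Proof.
move=> ca; have [m] := ubnP (size p1).
elim: m p1 p2 => // m IH p1 p2 sm p10 E.
have [/size_poly1P [c c0 p1E]|s1] := boolP (size p1 == 1%N).
  by exists (c^-1 *: p2) => w; rewrite hornerZ -E p1E hornerC mulrC mulfK.
have [w0 r1] := closed_rootP _ s1.
have r2 : root p2 w0 by rewrite rootE -E (eqP r1) mulr0.
have [t1 E1] := factor_theorem _ _ r1; have [t2 E2] := factor_theorem _ _ r2.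
have t10 : t1 != 0 by apply: contraNneq p10 => t10; rewrite E1 t10 mul0r.
apply: (IH t1 t2) => //.
  by move: sm; rewrite E1 size_Mmonic ?monicXsubC // size_XsubC addn2.
apply: (@continuous_eq_off _ _ w0).
- move=> w; apply: (@cvgM _ _ (nbhs w)); [exact: ca | exact: continuous_horner].
- exact: continuous_horner.
- move=> w ww0; have := E w; rewrite E1 E2 !hornerM hornerXsubC mulrA.
  by apply: mulIf; rewrite subr_eq0.
Qed.

(** * The centralizer of a shear *)

(** Invariance under the shear gives in turn: the second component depends on
    [w] only, for [phi] and for its inverse, so it is affine; the differences
    of the first component in the direction [z] depend on the increment and
    [w] only, so the first component is [a(w) z + b(w)]; and the commutation
    relation becomes [a(w) Q(w) = Q(c w + d)], where [a] has no zero. *)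
Lemma shear_centralizer (Q : {poly C}) (phi : C2 -> C2) : (1 < size Q)%N ->
  automorphism phi ->
  (forall z w, phi (z + Q.[w], w) = ((phi (z, w)).1 + Q.[(phi (z, w)).2], (phi (z, w)).2)) ->
  exists a b c d, [/\ a != 0, c != 0, forall w, differentiable b w
     & phi =1 elementary_map a b c d].
Proof.
move=> sQ [phi' [phiK phi'K dphi dphi']] comm.
have comm' z w : phi' (z + Q.[w], w) = ((phi' (z, w)).1 + Q.[(phi' (z, w)).2], (phi' (z, w)).2).
  apply: (can_inj phiK); rewrite phi'K comm -surjective_pairing.
  by rewrite !phi'K.
have d1 x : differentiable (fun x => (phi x).1) x.
  by apply: (differentiable_comp (dphi x)); exact: differentiable_fst.
have d2 x : differentiable (fun x => (phi x).2) x.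
  by apply: (differentiable_comp (dphi x)); exact: differentiable_snd.
have d2' x : differentiable (fun x => (phi' x).2) x.
  by apply: (differentiable_comp (dphi' x)); exact: differentiable_snd.
have g0 z w : (phi (z, w)).2 = (phi (0, w)).2.
  by apply: (@shear_invariant _ Q d2 sQ) => {}z {}w; rewrite comm.
have g0' z w : (phi' (z, w)).2 = (phi' (0, w)).2.
  by apply: (@shear_invariant _ Q d2' sQ) => {}z {}w; rewrite comm'.
pose gam w := (phi (0, w)).2; pose gam' w := (phi' (0, w)).2.
have gamK : cancel gam gam'.
  by move=> w; rewrite /gam /gam' -(g0' (phi (0, w)).1) -surjective_pairing phiK.
have gamK' : cancel gam' gam.
  by move=> w; rewrite /gam /gam' -(g0 (phi' (0, w)).1) -surjective_pairing phi'K.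
have [c [d gamE]] : exists c d, forall w, gam w = c * w + d.
  apply: (biholomorphism_affine _ _ gamK gamK') => w.
    exact: (@differentiable_slice2 (fun x => (phi x).2)).
  exact: (@differentiable_slice2 (fun x => (phi' x).2)).
pose b w := (phi (0, w)).1; pose a w := (phi (1, w)).1 - b w.
have fE z w : (phi (z, w)).1 = a w * z + b w.
  pose u s := (phi (s, w)).1 - (phi (0, w)).1.
  suff -> : a w * z = u z by rewrite subrK.
  apply/esym; apply: additive_linear => {z} [z|x y].
    apply: differentiableB; last exact: differentiable_cst.
    exact: (@differentiable_slice1 (fun x => (phi x).1)).
  have : (phi (x + y, w)).1 - (phi (x, w)).1 = (phi (0 + y, w)).1 - (phi (0, w)).1.
    apply: (@shear_invariant (fun p => (phi (p.1 + y, p.2)).1 - (phi p).1) Q) => // [p|{w u} z w].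
      apply: differentiableB => //.
      apply: (@differentiable_comp _ _ _ _ (fun p : C2 => (p.1 + y, p.2) : C2) (fun p => (phi p).1)) => //.
      apply: (@differentiable_pair _ _ _ _ (fun p : C2 => p.1 + y : C) (snd : C2 -> C)).
        by apply: differentiableD; [exact: differentiable_fst | exact: differentiable_cst].
      exact: differentiable_snd.
    by rewrite /= addrAC !comm /= (g0 (z + y)) (g0 z); ring.
  by rewrite add0r /u => E; rewrite [_ - _ + _]addrC -E; ring.
have db w : differentiable b w by exact: (@differentiable_slice2 (fun x => (phi x).1)).
have ca : continuous a.
  move=> w; apply: differentiable_continuous.
  by apply: differentiableB => //; exact: (@differentiable_slice2 (fun x => (phi x).1)).
have Q0 : Q != 0 by rewrite -size_poly_gt0; case: (size Q) sQ.
have [t tE] : exists t : {poly C}, forall w, a w = t.[w].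
  apply: (@continuous_polynomial_quotient a Q (Q \Po (c *: 'X + d%:P))) => // w.
  have := congr1 fst (comm 0 w); rewrite /= add0r !fE mulr0 add0r [RHS]addrC => /addIr ->.
  by rewrite horner_comp hornerD hornerZ hornerX hornerC -gamE.
have a0 w : a w != 0.
  apply/eqP => aw; have : phi (1, w) = phi (0, w).
    by rewrite [phi (1, w)]surjective_pairing [phi (0, w)]surjective_pairing !fE g0 aw !mul0r.
  by move/(can_inj phiK) => -[/eqP]; rewrite oner_eq0.
have [al al0 talE] : exists2 al : C, al != 0 & t = al%:P.
  apply/size_poly1P; rewrite -[_ == _]negbK; apply/negP => /closed_rootP [w].
  by rewrite rootE -tE (negbTE (a0 w)).
exists al, b, c, d; split=> //.
  apply/eqP => c0; have : gam 1 = gam 0 by rewrite !gamE c0 !mul0r.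
  by move/(can_inj gamK)/eqP; rewrite oner_eq0.
move=> [z w]; rewrite [LHS]surjective_pairing fE tE talE hornerC g0 -/(gam w) gamE.
by [].
Qed.

(** * Conjugation to a polynomial map *)

Lemma sum_by_parts (E : nat -> C) m :
  \sum_(i < m) i%:R * (E i.+1 - E i) = m%:R * E m - \sum_(i < m) E i.+1.
Proof.
elim: m => [|m IH]; first by rewrite !big_ord0 mul0r subr0.
rewrite !big_ord_recr /= IH -[m.+1%:R]natr1.
by set x := \sum_(i < m) _; ring.
Qed.

(** With [e_i = a^-i (b o g^i)], a sequence of period [M] on which composition
    with [g] acts by [e_i |-> a e_(i+1)], the first component of the [M]-th
    iterate is [z + a^-1 (e_0 + ... + e_(M-1))].  Hence the average of the
    [e_i] is [a Q / M].  Summation by parts shows that [b = e_0] differs from it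
    by [s o g - a s], where [s] is the weighted sum of the [i e_i] divided by
    [a M]. *)
Lemma conjugate_to_polynomial (Q : {poly C}) (a c d : C) (b : C -> C) (M : nat) :
  a != 0 -> c != 0 -> (forall w, differentiable b w) -> (0 < M)%N ->
  (forall z w, iter M (elementary_map a b c d) (z, w) = (z + Q.[w], w)) ->
  exists psi psi' : C2 -> C2, inverse_biholomorphisms psi psi' /\
    polynomial_elementary (psi' \o elementary_map a b c d \o psi).
Proof.
move=> a0 c0 db M0 hM.
pose gam w := c * w + d.
pose e w i : C := a ^- i * b (iter i gam w).
have iterE m z w : iter m (elementary_map a b c d) (z, w) =
    (a ^+ m * (z + a^-1 * \sum_(i < m) e w i), iter m gam w).
  elim: m => [|m IH]; first by rewrite big_ord0 mulr0 addr0 mul1r.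
  rewrite !iterS IH /elementary_map /=; congr pair.
  have -> : b (iter m gam w) = a ^+ m * e w m by rewrite mulrA divff ?mul1r // expf_neq0.
  by rewrite big_ord_recr /= exprS; set x := \sum_(i < m) _; field.
have gamM w : iter M gam w = w by have := hM 0 w; rewrite iterE => -[].
have aM : a ^+ M = 1.
  have := hM 1 0; have := hM 0 0; rewrite !iterE => -[E1 _] [E2 _].
  set X := a^-1 * _ in E1 E2.
  have -> : a ^+ M = a ^+ M * (1 + X) - a ^+ M * (0 + X) by ring.
  by rewrite E1 E2; ring.
have sum_e w : \sum_(i < M) e w i = a * Q.[w].
  have := hM 0 w; rewrite iterE aM mul1r !add0r => -[<- _].
  by rewrite mulrA divff // mul1r.
have M0' : M%:R != 0 :> C by rewrite pnatr_eq0 -lt0n.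
have e_gam w i : e (gam w) i = a * e w i.+1.
  by rewrite /e -iterSr exprS invfM; field; rewrite expf_neq0.
pose s w := (a * M%:R)^-1 * \sum_(i < M) i%:R * e w i.
have eM w : e w M = b w by rewrite /e gamM aM invr1 mul1r.
have e0 w : e w 0%N = b w by rewrite /e expr0 invr1 mul1r.
have cyc w : \sum_(i < M) e w i.+1 = \sum_(i < M) e w i.
  apply: (addrI (e w 0%N)); rewrite -(big_ord_recl M (fun i => e w i)) big_ord_recr /= eM e0.
  exact: addrC.
have s_gam w : b w + a * s w - s (gam w) = (a / M%:R *: Q).[w].
  have E1 : s (gam w) = M%:R^-1 * \sum_(i < M) i%:R * e w i.+1.
    rewrite /s !mulr_sumr; apply: eq_bigr => i _; rewrite e_gam.
    by set x := e _ _; field; rewrite M0' a0.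
  have E2 : a * s w = M%:R^-1 * \sum_(i < M) i%:R * e w i.
    by rewrite /s; set x := \sum_(i < M) _; field; rewrite M0' a0.
  have E3 : s (gam w) - a * s w = b w - M%:R^-1 * (a * Q.[w]).
    rewrite E1 E2 -mulrBr -sumrB; under eq_bigr do rewrite -mulrBr.
    by rewrite sum_by_parts cyc eM sum_e; field.
  rewrite hornerZ; have -> : s (gam w) = (s (gam w) - a * s w) + a * s w by ring.
  by rewrite E3; field.
have dgam i w : differentiable (iter i gam) w.
  elim: i => [|i IH]; first by [].
  apply: (differentiable_comp IH); rewrite /gam.
  apply: differentiableD; last exact: differentiable_cst.
  by apply: differentiableM => //; exact: differentiable_cst.
have ds w : differentiable s w.
  apply: differentiableM; first exact: differentiable_cst.
  have -> : (fun w => \sum_(i < M) i%:R * e w i) = \sum_(i < M) (fun w => i%:R * e w i).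
    by apply/funext => x; rewrite fct_sumE.
  apply: differentiable_sum => i.
  apply: differentiableM; first exact: differentiable_cst.
  apply: differentiableM; first exact: differentiable_cst.
  by apply: differentiable_comp; [exact: dgam | exact: db].
exists (elementary_map 1 s 1 0); eexists; split.
  by apply: elementary_inverse => //; exact: oner_neq0.
exists a, c, d, (a / M%:R *: Q); split=> // z w.
rewrite -s_gam /elementary_map /= !invr1 !mul1r !oppr0 !addr0.
by congr pair; rewrite -/(gam w); ring.
Qed.

Theorem mainTheorem3 (r k mu : nat) (beta : C) (q : {poly C})
    (hr : (1 <= r)%N) (hk : (1 <= k)%N)
    (hbeta : r.-primitive_root beta)
    (hq : q \is monic) (hdeg : size q = k.+1) :
  (forall N : nat, exists (n : nat) (phi : C2 -> C2),
      [/\ (N <= n)%N, automorphism phi & iter n phi =1 F_map r mu beta q])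
  /\
  (forall (n : nat) (phi : C2 -> C2),
      (1 <= n)%N -> automorphism phi -> iter n phi =1 F_map r mu beta q ->
      exists psi psi' : C2 -> C2,
        inverse_biholomorphisms psi psi' /\
        polynomial_elementary (psi' \o phi \o psi)).
Proof.
have br := prim_expr_order hbeta.
have b0 : beta != 0.
  by apply/eqP => b0; have /eqP := br; rewrite b0 expr0n gtn_eqF // eq_sym oner_eq0.
split=> [N|n phi n1 aphi phin].
  pose n := (r * N).+1; have n0 : n%:R != 0 :> C by rewrite pnatr_eq0.
  exists n, (F_map r mu beta (n%:R^-1 *: q)); split.
  - by rewrite leqW // leq_pmull.
  - eexists; rewrite (funext (F_map_elementary r mu beta _)).
    apply: elementary_inverse => //; first exact: expf_neq0.
    move=> w; apply: differentiableM; first exact: differentiable_cst.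
    exact: differentiable_horner.
  - move=> [z w]; rewrite F_map_iter // /F_map hornerZ.
    have -> : beta ^+ n = beta by rewrite exprS exprM br expr1n mulr1.
    by rewrite mulnC exprM exprS exprM br expr1n mulr1; congr pair; field.
pose Q := r%:R *: F_poly r mu q.
have r0 : r%:R != 0 :> C by rewrite pnatr_eq0 -lt0n.
have sQ : (1 < size Q)%N by rewrite size_scale //; exact: size_F_poly hr hk hdeg.
have iterM z w : iter (r * n) phi (z, w) = (z + Q.[w], w).
  have -> : iter (r * n) phi (z, w) = iter r (F_map r mu beta q) (z, w).
    rewrite -(funext phin); elim: (r) => // m IH.
    by rewrite mulSn iterD IH.
  by rewrite F_map_iter // mulnC exprM br expr1n !mul1r hornerZ F_polyE.
have [|a [b [c [d [a0 c0 db phiE]]]]] := shear_centralizer sQ aphi.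
  move=> z w; rewrite -(iterM z w) -iterS iterSr.
  by case: (phi (z, w)) => u v; rewrite iterM.
have M0 : (0 < r * n)%N by rewrite muln_gt0 hr n1.
have -> : phi = elementary_map a b c d by exact/funext.
by apply: (conjugate_to_polynomial a0 c0 db M0 (Q := Q)) => z w; rewrite -(funext phiE).
Qed.
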